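(* Let $T$ be a complete affine theory which has a first order model. Then the first order models of $T$ are exactly the extremal models of $T$, and the class of first order models of $T$ is the class of models of a complete first order theory (denoted $T_e$, the extremal theory of $T$).
   Context: Affine continuous logic: A Lipschitz language $L$ consists of constant, function and relation symbols together with a distinguished binary metric symbol $d$; each function and relation symbol carries a Lipschitz constant. An $L$-structure is a complete metric space $(M,d)$ with $d\le 1$ in which each constant symbol is an element, each $n$-ary function symbol $F$ is a $\lambda_F$-Lipschitz map $M^n\to M$ and each $n$-ary relation symbol $R$ is a $\lambda_R$-Lipschitz map $M^n\to[0,1]$ (where $M^n$ carries the metric $\sum_i d(x_i,y_i)$). Affine formulas are built from the constant $1$ and atomic formulas $R(t_1,\dots,t_n)$ ($R$ a relation symbol or $d$, $t_i$ terms) using only $r\cdot\phi$ ($r\in\mathbb R$), $\phi+\psi$, $\inf_x\phi$, $\sup_x\phi$; their values are real numbers. A condition is an expression $\phi\le\psi$; a theory is a set of closed conditions. Elementary equivalence and elementary substructure are defined with respect to the values of affine formulas. $T$ is complete if for every sentence $\phi$ there is a unique $r$ with $T\models\phi=r$. An $n$-type of $T$ is a maximal set of conditions in variables $\bar x=(x_1,\dots,x_n)$ satisfiable in a model of $T$; it is identified with the positive linear functional $\phi\mapsto p(\phi)$ (the value it forces for $\phi(\bar x)$) with $p(1)=1$. $S_n(T)$ is the set of $n$-types; it is convex and is compact in the logic topology (the coarsest topology making every $p\mapsto p(\phi)$ continuous). For a tuple $\bar a$ of $M\models T$, $tp(\bar a)$ is the type $\phi\mapsto\phi^M(\bar a)$.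 A type is extreme if it is an extreme point of $S_n(T)$. A model $M$ of $T$ is extremal if $tp(\bar a)$ is extreme for every finite tuple $\bar a$ of $M$. A first order model is an $L$-structure in which $d$ is the discrete $\{0,1\}$-valued metric and every relation symbol takes values in $\{0,1\}$; it is regarded as an ordinary first order structure (with $d$ read as equality and relations as their characteristic functions). *)

(* Defs.v *)
From Stdlib Require Import Reals Lra.
From Coquelicot Require Import Coquelicot.
Open Scope R_scope.

(* Constant symbols are the 0-ary function symbols. The metric symbol d is
   built into the syntax (atomic formula [fdist]). *)
Record language := {
  Fsym : Type;
  Rsym : Type;
  farity : Fsym -> nat;
  rarity : Rsym -> nat;
  flip : Fsym -> R;
  rlip : Rsym -> R;
  flip_nonneg : forall f, 0 <= flip f;
  rlip_nonneg : forall r, 0 <= rlip r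
}.

Fixpoint sumR (n : nat) (g : nat -> R) : R :=
  match n with O => 0 | S k => sumR k g + g k end.

(* Argument tuples are represented as [nat -> X]; only the first [arity]
   coordinates matter (this is enforced by the Lipschitz conditions, resp.
   by explicit locality axioms for first order structures). *)

Section Syntax.
Variable L : language.

Inductive term : Type :=
| tvar : nat -> term
| tapp : forall f : Fsym L, (nat -> term) -> term.

Inductive formula : Type :=
| fone : formula
| fatom : forall r : Rsym L, (nat -> term) -> formula
| fdist : term -> term -> formula
| fscal : R -> formula -> formula
| fadd : formula -> formula -> formula
| finf : nat -> formula -> formula
| fsup : nat -> formula -> formula.

Fixpoint tfv (P : nat -> Prop) (t : term) : Prop :=
  match t with
  | tvar i => P i
  | tapp f ts => forall i, (i < farity L f)%nat -> tfv P (ts i)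
  end.

Fixpoint ffv (P : nat -> Prop) (phi : formula) : Prop :=
  match phi with
  | fone => True
  | fatom r ts => forall i, (i < rarity L r)%nat -> tfv P (ts i)
  | fdist t1 t2 => tfv P t1 /\ tfv P t2
  | fscal _ p => ffv P p
  | fadd p q => ffv P p /\ ffv P q
  | finf x p => ffv (fun i => i = x \/ P i) p
  | fsup x p => ffv (fun i => i = x \/ P i) p
  end.

Definition sentence (phi : formula) : Prop := ffv (fun _ => False) phi.
Definition formula_in (n : nat) (phi : formula) : Prop := ffv (fun i => (i < n)%nat) phi.

(* first order formulas in the same signature (d read as equality) *)
Inductive fformula : Type :=
| Ffalse : fformula
| Feq : term -> term -> fformula
| Frel : forall r : Rsym L, (nat -> term) -> fformula
| Fneg : fformula -> fformula
| Fand : fformula -> fformula -> fformula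
| For : fformula -> fformula -> fformula
| Fimp : fformula -> fformula -> fformula
| Fall : nat -> fformula -> fformula
| Fex : nat -> fformula -> fformula.

Fixpoint Ffv (P : nat -> Prop) (phi : fformula) : Prop :=
  match phi with
  | Ffalse => True
  | Feq t1 t2 => tfv P t1 /\ tfv P t2
  | Frel r ts => forall i, (i < rarity L r)%nat -> tfv P (ts i)
  | Fneg p => Ffv P p
  | Fand p q | For p q | Fimp p q => Ffv P p /\ Ffv P q
  | Fall x p | Fex x p => Ffv (fun i => i = x \/ P i) p
  end.

Definition fsentence (phi : fformula) : Prop := Ffv (fun _ => False) phi.
End Syntax.

Arguments tvar {L}.
Arguments tapp {L}.
Arguments fone {L}.
Arguments fatom {L}.
Arguments fdist {L}.
Arguments fscal {L}.
Arguments fadd {L}.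
Arguments finf {L}.
Arguments fsup {L}.

Definition upd {M : Type} (e : nat -> M) (x : nat) (m : M) : nat -> M :=
  fun i => if Nat.eqb i x then m else e i.

Record Lstructure (L : language) := {
  carrier :> Type;
  carrier_inhabited : inhabited carrier;
  dist : carrier -> carrier -> R;
  dist_refl : forall x, dist x x = 0;
  dist_sep : forall x y, dist x y = 0 -> x = y;
  dist_sym : forall x y, dist x y = dist y x;
  dist_tri : forall x y z, dist x z <= dist x y + dist y z;
  dist_le1 : forall x y, dist x y <= 1;
  complete : forall u : nat -> carrier,
      (forall eps, 0 < eps -> exists N, forall m n, (N <= m)%nat -> (N <= n)%nat ->
          dist (u m) (u n) < eps) ->
      exists x, forall eps, 0 < eps -> exists N, forall n, (N <= n)%nat -> dist (u n) x < eps;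
  Fint : forall f : Fsym L, (nat -> carrier) -> carrier;
  Rint : forall r : Rsym L, (nat -> carrier) -> R;
  Fint_lip : forall f a b,
      dist (Fint f a) (Fint f b) <= flip L f * sumR (farity L f) (fun i => dist (a i) (b i));
  Rint_lip : forall r a b,
      Rabs (Rint r a - Rint r b) <= rlip L r * sumR (rarity L r) (fun i => dist (a i) (b i));
  Rint_range : forall r a, 0 <= Rint r a <= 1
}.

Arguments dist {L} _ _ _.
Arguments Fint {L} _ _ _.
Arguments Rint {L} _ _ _.

Fixpoint teval {L} (M : Lstructure L) (t : term L) (e : nat -> M) : M :=
  match t with
  | tvar i => e i
  | tapp f ts => Fint M f (fun i => teval M (ts i) e)
  end.

(* value of an affine formula; inf/sup are taken in Rbar and converted
   (they are finite: values are bounded and M is nonempty) *)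
Fixpoint fval {L} (M : Lstructure L) (phi : formula L) (e : nat -> M) : R :=
  match phi with
  | fone => 1
  | fatom r ts => Rint M r (fun i => teval M (ts i) e)
  | fdist t1 t2 => dist M (teval M t1 e) (teval M t2 e)
  | fscal c p => c * fval M p e
  | fadd p q => fval M p e + fval M q e
  | finf x p => real (Glb_Rbar (fun y => exists m : M, y = fval M p (upd e x m)))
  | fsup x p => real (Lub_Rbar (fun y => exists m : M, y = fval M p (upd e x m)))
  end.

(* a theory is a set of closed conditions phi <= psi *)
Record Ltheory (L : language) := {
  cond : formula L -> formula L -> Prop;
  cond_closed : forall phi psi, cond phi psi -> sentence L phi /\ sentence L psi
}.
Arguments cond {L} _ _ _.

Definition Models {L} (M : Lstructure L) (T : Ltheory L) : Prop :=
  forall phi psi, cond T phi psi -> forall e : nat -> M, fval M phi e <= fval M psi e.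

Definition complete_theory {L} (T : Ltheory L) : Prop :=
  forall phi, sentence L phi ->
    exists! r : R, forall M : Lstructure L, Models M T -> forall e : nat -> M, fval M phi e = r.

Definition tp {L} (M : Lstructure L) (a : nat -> M) : formula L -> R :=
  fun phi => fval M phi a.

(* p is an n-type of T (only its values on formulas in x_0..x_{n-1} matter) *)
Definition in_S {L} (T : Ltheory L) (n : nat) (p : formula L -> R) : Prop :=
  exists (M : Lstructure L) (a : nat -> M), Models M T /\
    forall phi, formula_in L n phi -> p phi = tp M a phi.

Definition extreme_type {L} (T : Ltheory L) (n : nat) (p : formula L -> R) : Prop :=
  in_S T n p /\
  forall q r (t : R), in_S T n q -> in_S T n r -> 0 < t < 1 ->
    (forall phi, formula_in L n phi -> p phi = t * q phi + (1 - t) * r phi) ->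
    forall phi, formula_in L n phi -> q phi = r phi.

Definition extremal {L} (T : Ltheory L) (M : Lstructure L) : Prop :=
  forall (n : nat) (a : nat -> M), extreme_type T n (tp M a).

Definition first_order_model {L} (M : Lstructure L) : Prop :=
  (forall x y : M, dist M x y = 0 \/ dist M x y = 1) /\
  (forall r (a : nat -> M), Rint M r a = 0 \/ Rint M r a = 1).

Record FOstructure (L : language) := {
  fcarrier :> Type;
  fcarrier_inhabited : inhabited fcarrier;
  FFint : forall f : Fsym L, (nat -> fcarrier) -> fcarrier;
  FRint : forall r : Rsym L, (nat -> fcarrier) -> Prop;
  FFint_local : forall f a b, (forall i, (i < farity L f)%nat -> a i = b i) ->
      FFint f a = FFint f b;
  FRint_local : forall r a b, (forall i, (i < rarity L r)%nat -> a i = b i) ->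
      (FRint r a <-> FRint r b)
}.
Arguments FFint {L} _ _ _.
Arguments FRint {L} _ _ _.

Fixpoint fteval {L} (N : FOstructure L) (t : term L) (e : nat -> N) : N :=
  match t with
  | tvar i => e i
  | tapp f ts => FFint N f (fun i => fteval N (ts i) e)
  end.

Fixpoint fsat {L} (N : FOstructure L) (phi : fformula L) (e : nat -> N) : Prop :=
  match phi with
  | Ffalse => False
  | Feq t1 t2 => fteval N t1 e = fteval N t2 e
  | Frel r ts => FRint N r (fun i => fteval N (ts i) e)
  | Fneg p => ~ fsat N p e
  | Fand p q => fsat N p e /\ fsat N q e
  | For p q => fsat N p e \/ fsat N q e
  | Fimp p q => fsat N p e -> fsat N q e
  | Fall x p => forall m : N, fsat N p (upd e x m)
  | Fex x p => exists m : N, fsat N p (upd e x m)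
  end.

Definition FOtheory (L : language) := fformula L -> Prop.

Definition FModels {L} (N : FOstructure L) (Te : FOtheory L) : Prop :=
  forall s, Te s -> forall e : nat -> N, fsat N s e.

Definition FO_complete {L} (Te : FOtheory L) : Prop :=
  (forall s, Te s -> fsentence L s) /\
  (exists N : FOstructure L, FModels N Te) /\
  forall s, fsentence L s ->
    (forall N : FOstructure L, FModels N Te -> forall e : nat -> N, fsat N s e) \/
    (forall N : FOstructure L, FModels N Te -> forall e : nat -> N, ~ fsat N s e).

(* M (a first order L-structure) regarded as an ordinary first order
   structure is isomorphic to N: d is read as equality (so the map is a
   bijection) and a relation holds iff its value is 1. *)
Definition iso_FO {L} (M : Lstructure L) (N : FOstructure L) : Prop :=
  exists (h : M -> N) (g : N -> M),
    (forall x, g (h x) = x) /\ (forall y, h (g y) = y) /\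
    (forall f (a : nat -> M), h (Fint M f a) = FFint N f (fun i => h (a i))) /\
    (forall r (a : nat -> M), Rint M r a = 1 <-> FRint N r (fun i => h (a i))).

(* Main.v *)
From Stdlib Require Import Reals Lra Lia List Classical ClassicalEpsilon.
From Stdlib Require Import FunctionalExtensionality ProofIrrelevance PeanoNat.
From Coquelicot Require Import Coquelicot.
Require Import Defs.
Open Scope R_scope.

(* Over the theory T, first order formulas and affine formulas have the same
   expressive power.  Affine formulas take finitely many values in first order
   models, each at a first order definable set.  Conversely the indicator of
   every first order formula is an affine formula: quantifiers are sup and inf,
   and conjunction is sup_u ([u = y] + phi(u) + psi(u) - 2) as soon as
   "phi and psi" is satisfiable, which T decides; the indicator of equality of
   tuples is affine because [a = b and c = d] is a linear combination of suprema
   of nonnegative combinations of [x = a], [x = b], [x = c], [x = d].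
   Hence all first order models of T are elementarily equivalent, and their types
   are extreme: phi(a) = r is forced by an affine formula with values in [0, 1]
   taking its maximum 1 at a.  If an atomic formula rho has value w with
   0 < w < 1 at a tuple a of a model M, then phi |-> (phi rho)(a) / w and
   phi |-> (phi (1 - rho))(a) / (1 - w) are types realized in models
   obtained from M by conditioning, and tp(a) is a proper convex combination of
   them. *)

(** * Suprema and finite sums *)

(** The language offers neither products nor minima, so the indicator of a conjunction is the crux.
    In [sup_u ([u = y] + phi(u) + psi(u) - 2)] the point [u = y] contributes 1 if both hold at [y]
    and at most 0 otherwise, every other [u] contributes at most 0, and a common witness keeps the
    supremum from being negative. Such identities are proved in first order models only. What
    crosses to an arbitrary model [M] of [T] is an inequality between affine formulas valid under
    all assignments: it says that the supremum of the difference, a sentence, is at most 0, and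
    completeness fixes the value of that sentence. Every fact needed in [M] is therefore first put
    as an affine inequality in the given first order model [M0]. Conditioning works for this reason:
    the product of a formula with an event is affine in [M0], and [M] inherits each affine law which
    these products obey there, although multiplication has no direct meaning for the formulas of
    [M]. *)

Definition supM {A : Type} (f : A -> R) : R :=
  real (Lub_Rbar (fun y => exists m : A, y = f m)).
Definition infM {A : Type} (f : A -> R) : R :=
  real (Glb_Rbar (fun y => exists m : A, y = f m)).

(** The bound excludes the value plus infinity, which [real] would turn into 0; for formulas it
    comes from [fval_bounded]. *)
Lemma supM_ge {A : Type} (f : A -> R) (B : R) (m : A) :
  (forall m, f m <= B) -> f m <= supM f.
Proof.
  intros HB. unfold supM.
  destruct (Lub_Rbar_correct (fun y => exists m : A, y = f m)) as [H1 H2].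
  assert (H3 : Rbar_le (Lub_Rbar (fun y => exists m : A, y = f m)) (Finite B))
    by (apply H2; intros y [m' ->]; apply HB).
  specialize (H1 (f m) (ex_intro _ m eq_refl)).
  destruct (Lub_Rbar _); simpl in *; tauto.
Qed.

Lemma supM_le {A : Type} (f : A -> R) (c : R) :
  inhabited A -> (forall m, f m <= c) -> supM f <= c.
Proof.
  intros [m0] Hc. unfold supM.
  destruct (Lub_Rbar_correct (fun y => exists m : A, y = f m)) as [H1 H2].
  assert (H3 : Rbar_le (Lub_Rbar (fun y => exists m : A, y = f m)) (Finite c))
    by (apply H2; intros y [m' ->]; apply Hc).
  specialize (H1 (f m0) (ex_intro _ m0 eq_refl)).
  destruct (Lub_Rbar _); simpl in *; tauto.
Qed.

Lemma infM_opp {A : Type} (f : A -> R) (B : R) :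
  inhabited A -> (forall m, B <= f m) -> infM f = - supM (fun m => - f m).
Proof.
  intros [m0] HB. unfold infM.
  destruct (Glb_Rbar_correct (fun y => exists m : A, y = f m)) as [H1 H2].
  assert (H3 : Rbar_le (Finite B) (Glb_Rbar (fun y => exists m : A, y = f m)))
    by (apply H2; intros y [m' ->]; apply HB).
  assert (HB' : forall m, - f m <= - B) by (intros m; specialize (HB m); lra).
  assert (H4 : Rbar_le (- supM (fun m => - f m)) (Glb_Rbar (fun y => exists m : A, y = f m))).
  { apply H2. intros y [m ->]. simpl.
    pose proof (supM_ge (fun m => - f m) _ m HB'). simpl in H. lra. }
  assert (H5 : forall m, Rbar_le (Glb_Rbar (fun y => exists m : A, y = f m)) (f m))
    by (intros m; apply H1; now exists m).
  pose proof (H5 m0) as H6.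
  destruct (Glb_Rbar _) as [r| |]; simpl in *; try tauto.
  assert (supM (fun m => - f m) <= - r); [|lra].
  apply supM_le; [now constructor|]. intros m. specialize (H5 m). simpl in H5. lra.
Qed.

Lemma supM_scal {A : Type} (f : A -> R) (B c : R) :
  inhabited A -> (forall m, f m <= B) -> 0 <= c -> supM (fun m => c * f m) = c * supM f.
Proof.
  intros HA HB Hc.
  assert (HB' : forall m, c * f m <= c * B)
    by (intros m; apply Rmult_le_compat_l; auto).
  apply Rle_antisym.
  - apply supM_le; auto. intros m. apply Rmult_le_compat_l; auto. eapply supM_ge; eauto.
  - destruct Hc as [Hc| <-].
    + apply Rmult_le_reg_l with (/ c); [now apply Rinv_0_lt_compat|].
      rewrite <- Rmult_assoc, Rinv_l, Rmult_1_l by lra.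
      apply supM_le; auto. intros m.
      apply Rmult_le_reg_l with c; auto.
      rewrite <- Rmult_assoc, Rinv_r, Rmult_1_l by lra.
      apply (supM_ge (fun m => c * f m) _ m HB').
    + destruct HA as [m0]. pose proof (supM_ge (fun m => 0 * f m) 0 m0) as H.
      simpl in H. rewrite Rmult_0_l in *. apply H. intros; lra.
Qed.

Lemma sumR_ext (n : nat) (g h : nat -> R) :
  (forall i, (i < n)%nat -> g i = h i) -> sumR n g = sumR n h.
Proof.
  induction n; simpl; intros H; [reflexivity|].
  rewrite IHn by (intros; apply H; lia). now rewrite H by lia.
Qed.

Lemma sumR_le (n : nat) (g h : nat -> R) :
  (forall i, (i < n)%nat -> g i <= h i) -> sumR n g <= sumR n h.
Proof.
  induction n; simpl; intros H; [lra|].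
  apply Rplus_le_compat; [apply IHn; intros; apply H; lia|apply H; lia].
Qed.

Lemma sumR_zero (n : nat) (g : nat -> R) :
  (forall i, (i < n)%nat -> g i = 0) -> sumR n g = 0.
Proof.
  induction n; simpl; intros H; [reflexivity|].
  rewrite IHn by (intros; apply H; lia). rewrite H by lia. lra.
Qed.

Lemma sumR_nonneg (n : nat) (g : nat -> R) :
  (forall i, (i < n)%nat -> 0 <= g i) -> 0 <= sumR n g.
Proof.
  intros H. rewrite <- (sumR_zero n (fun _ => 0)) by reflexivity. now apply sumR_le.
Qed.

Lemma sumR_scal (n : nat) (c : R) (g : nat -> R) :
  sumR n (fun i => c * g i) = c * sumR n g.
Proof. induction n; simpl; [lra|]. rewrite IHn. lra. Qed.

(** * Values of affine formulas *)

Section Values.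
Context {L : language}.
Implicit Types (M : Lstructure L) (phi psi : formula L) (t : term L).

Lemma dist_nonneg M (x y : M) : 0 <= dist M x y.
Proof.
  pose proof (dist_tri L M x y x). pose proof (dist_refl L M x).
  pose proof (dist_sym L M x y). lra.
Qed.

Lemma Fint_local M f (a b : nat -> M) :
  (forall i, (i < farity L f)%nat -> a i = b i) -> Fint M f a = Fint M f b.
Proof.
  intros H. apply dist_sep. apply Rle_antisym; [|apply dist_nonneg].
  eapply Rle_trans; [apply Fint_lip|]. rewrite sumR_zero; [lra|].
  intros i Hi. rewrite H by auto. apply dist_refl.
Qed.

Lemma Rint_local M r (a b : nat -> M) :
  (forall i, (i < rarity L r)%nat -> a i = b i) -> Rint M r a = Rint M r b.
Proof.
  intros H. pose proof (Rint_lip L M r a b) as Hl.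
  rewrite sumR_zero in Hl.
  - pose proof (Rabs_pos (Rint M r a - Rint M r b)).
    rewrite Rmult_0_r in Hl. apply Rminus_diag_uniq.
    apply Rabs_eq_0. lra.
  - intros i Hi. rewrite H by auto. apply dist_refl.
Qed.

Lemma fval_fsup M x phi (e : nat -> M) :
  fval M (fsup x phi) e = supM (fun m => fval M phi (upd e x m)).
Proof. reflexivity. Qed.

Lemma fval_bounded M phi : exists B, forall e, Rabs (fval M phi e) <= B.
Proof.
  induction phi as [ |r ts|t1 t2|c p [B HB]|p [B HB] q [C HC]|x p [B HB]|x p [B HB]].
  - exists 1. intros e. simpl. rewrite Rabs_R1. lra.
  - exists 1. intros e. simpl. pose proof (Rint_range L M r (fun i => teval M (ts i) e)).
    rewrite Rabs_pos_eq; lra.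
  - exists 1. intros e. simpl. rewrite Rabs_pos_eq by apply dist_nonneg. apply dist_le1.
  - exists (Rabs c * B). intros e. simpl. rewrite Rabs_mult.
    apply Rmult_le_compat_l; [apply Rabs_pos|auto].
  - exists (B + C). intros e. simpl. eapply Rle_trans; [apply Rabs_triang|].
    specialize (HB e); specialize (HC e); lra.
  - exists B. intros e. simpl. change (Rabs (infM (fun m => fval M p (upd e x m))) <= B).
    assert (HB' : forall m, - B <= fval M p (upd e x m) <= B)
      by (intros m; apply Rabs_le_between, HB).
    rewrite (infM_opp _ (- B)); [|apply carrier_inhabited|apply HB'].
    rewrite Rabs_Ropp. apply Rabs_le_between. split.
    + destruct (carrier_inhabited L M) as [m].
      eapply Rle_trans; [|apply (supM_ge _ B m)]; [specialize (HB' m); simpl; lra|].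
      intros m'; specialize (HB' m'); lra.
    + apply supM_le; [apply carrier_inhabited|]. intros m'; specialize (HB' m'); lra.
  - exists B. intros e. rewrite fval_fsup.
    assert (HB' : forall m, - B <= fval M p (upd e x m) <= B)
      by (intros m; apply Rabs_le_between, HB).
    apply Rabs_le_between. split.
    + destruct (carrier_inhabited L M) as [m].
      eapply Rle_trans; [|apply (supM_ge _ B m)]; [specialize (HB' m); simpl; lra|].
      intros m'; specialize (HB' m'); lra.
    + apply supM_le; [apply carrier_inhabited|]. intros m'; specialize (HB' m'); lra.
Qed.

Lemma fsup_ge M x phi (e : nat -> M) (m : M) :
  fval M phi (upd e x m) <= fval M (fsup x phi) e.
Proof.
  destruct (fval_bounded M phi) as [B HB]. rewrite fval_fsup.
  apply (supM_ge (fun m => fval M phi (upd e x m)) B). intros m'. 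
  apply (Rabs_le_between _ B), HB.
Qed.

Lemma fsup_le M x phi (e : nat -> M) (c : R) :
  (forall m, fval M phi (upd e x m) <= c) -> fval M (fsup x phi) e <= c.
Proof. intros H. apply supM_le; [apply carrier_inhabited|exact H]. Qed.

(** Reduces [finf] to [fsup] in those inductions where suprema need an argument of their own. *)
Lemma finf_opp M x phi (e : nat -> M) :
  fval M (finf x phi) e = - fval M (fsup x (fscal (-1) phi)) e.
Proof.
  destruct (fval_bounded M phi) as [B HB].
  change (infM (fun m => fval M phi (upd e x m)) =
          - supM (fun m => -1 * fval M phi (upd e x m))).
  rewrite (infM_opp _ (- B)).
  - f_equal. f_equal. apply functional_extensionality. intros m. lra.
  - apply carrier_inhabited.
  - intros m. apply (Rabs_le_between _ B), HB.
Qed.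

(** The bound variables may differ because substitution renames them. *)
Lemma fval_fsup_ext M x y phi psi (e e' : nat -> M) :
  (forall m, fval M phi (upd e x m) = fval M psi (upd e' y m)) ->
  fval M (fsup x phi) e = fval M (fsup y psi) e'.
Proof.
  intros H. rewrite !fval_fsup. f_equal. now apply functional_extensionality.
Qed.

Lemma fval_finf_ext M x y phi psi (e e' : nat -> M) :
  (forall m, fval M phi (upd e x m) = fval M psi (upd e' y m)) ->
  fval M (finf x phi) e = fval M (finf y psi) e'.
Proof.
  intros H. simpl. do 2 f_equal. apply functional_extensionality. intros z.
  f_equal. apply functional_extensionality. intros m. now rewrite H.
Qed.

(** * Free variables and substitution *)

Lemma tfv_mono (P Q : nat -> Prop) t : (forall i, P i -> Q i) -> tfv L P t -> tfv L Q t.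
Proof. induction t; simpl; auto. Qed.

Lemma ffv_mono phi : forall P Q : nat -> Prop,
  (forall i, P i -> Q i) -> ffv L P phi -> ffv L Q phi.
Proof.
  induction phi; simpl; intros P Q H; auto.
  - intros Hi i Hr. eapply tfv_mono; eauto.
  - intros [H1 H2]; split; eapply tfv_mono; eauto.
  - now apply IHphi.
  - intros [H1 H2]; split; eauto.
  - apply IHphi. intros i [->|Hi]; auto.
  - apply IHphi. intros i [->|Hi]; auto.
Qed.

Lemma Ffv_mono (s : fformula L) : forall P Q : nat -> Prop,
  (forall i, P i -> Q i) -> Ffv L P s -> Ffv L Q s.
Proof.
  induction s; simpl; intros P Q H; auto.
  - intros [H1 H2]; split; eapply tfv_mono; eauto.
  - intros Hi i Hr. eapply tfv_mono; eauto.
  - apply IHs; auto.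
  - intros [H1 H2]; split; eauto.
  - intros [H1 H2]; split; eauto.
  - intros [H1 H2]; split; eauto.
  - apply IHs. intros i [->|Hi]; auto.
  - apply IHs. intros i [->|Hi]; auto.
Qed.

(** Arguments are functions on all of [nat], of which only finitely many count; this takes the place
    of a maximum over an argument list. *)
Lemma uniform_bound (Q : nat -> nat -> Prop) (k : nat) :
  (forall i n n', (n <= n')%nat -> Q i n -> Q i n') ->
  (forall i, exists n, Q i n) -> exists n, forall i, (i < k)%nat -> Q i n.
Proof.
  intros Hm HQ. induction k as [|k [n Hn]].
  - exists 0%nat. intros; lia.
  - destruct (HQ k) as [n' Hn']. exists (Nat.max n n'). intros i Hi.
    destruct (Nat.eq_dec i k) as [->|].
    + apply (Hm k n'); auto; lia.
    + apply (Hm i n); [lia|]. apply Hn. lia.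
Qed.

Lemma tfv_le n n' t :
  (n <= n')%nat -> tfv L (fun i => (i < n)%nat) t -> tfv L (fun i => (i < n')%nat) t.
Proof. intros H. apply tfv_mono. intros; lia. Qed.

Lemma term_bound t : exists n, tfv L (fun i => (i < n)%nat) t.
Proof.
  induction t as [i|f ts IH].
  - exists (S i). simpl. lia.
  - simpl. apply (uniform_bound (fun i n => tfv L (fun i => (i < n)%nat) (ts i))); auto.
    intros. eapply tfv_le; eauto.
Qed.

Lemma terms_bound (ts : nat -> term L) k :
  exists n, forall i, (i < k)%nat -> tfv L (fun i => (i < n)%nat) (ts i).
Proof.
  apply (uniform_bound (fun i n => tfv L (fun i => (i < n)%nat) (ts i))).
  - intros. eapply tfv_le; eauto.
  - intros. apply term_bound.
Qed.

Lemma formula_in_le n n' phi : (n <= n')%nat -> formula_in L n phi -> formula_in L n' phi.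
Proof. intros H. apply ffv_mono. intros; lia. Qed.

Lemma formula_bound phi : exists n, formula_in L n phi.
Proof.
  unfold formula_in.
  induction phi as [ |r ts|t1 t2|c p [n Hn]|p [n Hn] q [k Hk]|x p [n Hn]|x p [n Hn]]; simpl.
  - now exists 0%nat.
  - apply terms_bound.
  - destruct (term_bound t1) as [n Hn], (term_bound t2) as [k Hk].
    exists (Nat.max n k). split; [apply (tfv_le n)|apply (tfv_le k)]; auto; lia.
  - now exists n.
  - exists (Nat.max n k). split; [eapply (formula_in_le n)|eapply (formula_in_le k)]; eauto; lia.
  - exists n. eapply ffv_mono; [|eauto]. auto.
  - exists n. eapply ffv_mono; [|eauto]. auto.
Qed.

Lemma fformula_bound (s : fformula L) : exists n, Ffv L (fun i => (i < n)%nat) s.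
Proof.
  assert (Hle : forall n n' (p : fformula L), (n <= n')%nat ->
     Ffv L (fun i => (i < n)%nat) p -> Ffv L (fun i => (i < n')%nat) p).
  { intros n n' p H. apply Ffv_mono. intros; lia. }
  induction s as [ |t1 t2|r ts|p [n Hn]|p [n Hn] q [k Hk]|p [n Hn] q [k Hk]
    |p [n Hn] q [k Hk]|x p [n Hn]|x p [n Hn]]; simpl;
  [ | | |exists n; exact Hn|exists (Nat.max n k)|exists (Nat.max n k)|exists (Nat.max n k)
    |exists n|exists n];
  try (split; [eapply (Hle n)|eapply (Hle k)]; eauto; lia);
  try (eapply Ffv_mono; [|exact Hn]; auto; fail).
  - now exists 0%nat.
  - destruct (term_bound t1) as [n Hn], (term_bound t2) as [k Hk].
    exists (Nat.max n k). split; [apply (tfv_le n)|apply (tfv_le k)]; auto; lia.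
  - apply terms_bound.
Qed.

Lemma teval_local M (P : nat -> Prop) t (e e' : nat -> M) :
  tfv L P t -> (forall i, P i -> e i = e' i) -> teval M t e = teval M t e'.
Proof.
  intros Ht He. induction t as [i|f ts IH]; simpl in *; auto.
  apply Fint_local. intros i Hi. apply IH. now apply Ht.
Qed.

Lemma upd_same {A : Type} (e : nat -> A) x m : upd e x m x = m.
Proof. unfold upd. now rewrite Nat.eqb_refl. Qed.

Lemma upd_other {A : Type} (e : nat -> A) x m i : i <> x -> upd e x m i = e i.
Proof. unfold upd. intros H. now apply Nat.eqb_neq in H as ->. Qed.

Lemma upd_agree {A : Type} (P : nat -> Prop) (e e' : nat -> A) x m :
  (forall i, P i -> e i = e' i) ->
  forall i, i = x \/ P i -> upd e x m i = upd e' x m i.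
Proof.
  intros He i Hi. destruct (Nat.eq_dec i x) as [->|Hx].
  - now rewrite !upd_same.
  - rewrite !upd_other by auto. destruct Hi; [tauto|auto].
Qed.

Lemma fval_local M phi : forall (P : nat -> Prop) (e e' : nat -> M),
  ffv L P phi -> (forall i, P i -> e i = e' i) -> fval M phi e = fval M phi e'.
Proof.
  induction phi; intros P e e' Hp He.
  - reflexivity.
  - simpl. apply Rint_local. intros i Hi. eapply teval_local; [apply Hp, Hi|auto].
  - destruct Hp. simpl. f_equal; eapply teval_local; eauto.
  - simpl. f_equal. eapply IHphi; eauto.
  - destruct Hp. simpl. f_equal; eauto.
  - apply fval_finf_ext. intros m. eapply IHphi; [exact Hp|]. now apply upd_agree.
  - apply fval_fsup_ext. intros m. eapply IHphi; [exact Hp|]. now apply upd_agree.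
Qed.

Fixpoint tsub (s : nat -> term L) t : term L :=
  match t with
  | tvar i => s i
  | tapp f ts => tapp f (fun i => tsub s (ts i))
  end.

Lemma teval_tsub M (s : nat -> term L) t (e : nat -> M) :
  teval M (tsub s t) e = teval M t (fun i => teval M (s i) e).
Proof.
  induction t as [i|f ts IH]; simpl; auto. f_equal. now apply functional_extensionality.
Qed.

Lemma subst_exists phi : forall s : nat -> term L,
  exists psi, forall M (e : nat -> M),
    fval M psi e = fval M phi (fun i => teval M (s i) e).
Proof.
  (* Renaming against capture: [z] lies above all variables of the terms [s i] that replace
     variables of [p], so a new value at [z] leaves these terms unchanged. *)
  assert (Hq : forall p x (s : nat -> term L), exists z, forall psi,
    (forall M (e : nat -> M),
      fval M psi e = fval M p (fun i => teval M (upd s x (tvar z) i) e)) ->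
    forall M (e : nat -> M) m,
      fval M psi (upd e z m) = fval M p (upd (fun i => teval M (s i) e) x m)).
  { intros p x s. destruct (formula_bound p) as [n Hn].
    destruct (terms_bound s n) as [z Hz]. exists z. intros psi H M e m. rewrite H.
    eapply fval_local; [exact Hn|]. intros i Hi. cbv beta.
    destruct (Nat.eq_dec i x) as [->|Hx].
    - rewrite !upd_same. simpl. now rewrite upd_same.
    - rewrite !upd_other by auto. eapply teval_local; [now apply Hz|].
      intros j Hj. apply upd_other. cbv beta in Hj. lia. }
  induction phi as [ |r ts|t1 t2|c p IH|p IHp q IHq|x p IH|x p IH]; intros s.
  - now exists fone.
  - exists (fatom r (fun i => tsub s (ts i))). intros M e. simpl. f_equal.
    apply functional_extensionality. intros i. apply teval_tsub.
  - exists (fdist (tsub s t1) (tsub s t2)). intros M e. simpl. now rewrite !teval_tsub.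
  - destruct (IH s) as [psi Hpsi]. exists (fscal c psi). intros M e. simpl. now rewrite Hpsi.
  - destruct (IHp s) as [p' Hp'], (IHq s) as [q' Hq']. exists (fadd p' q').
    intros M e. simpl. now rewrite Hp', Hq'.
  - destruct (Hq p x s) as [z Hz]. destruct (IH (upd s x (tvar z))) as [psi Hpsi].
    exists (finf z psi). intros M e. apply fval_finf_ext. intros m. now apply Hz.
  - destruct (Hq p x s) as [z Hz]. destruct (IH (upd s x (tvar z))) as [psi Hpsi].
    exists (fsup z psi). intros M e. apply fval_fsup_ext. intros m. now apply Hz.
Qed.

(** * Suprema over blocks of variables, and transfer between models *)

Fixpoint fsups (m n : nat) phi : formula L :=
  match n with O => phi | S k => fsup m (fsups (S m) k phi) end.

Lemma ffv_fsups n phi : forall m (P : nat -> Prop),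
  ffv L (fun i => (m <= i < m + n)%nat \/ P i) phi -> ffv L P (fsups m n phi).
Proof.
  induction n as [|n IH]; simpl; intros m P H.
  - eapply ffv_mono; [|exact H]. intros i [Hi|Hi]; [lia|auto].
  - apply IH. eapply ffv_mono; [|exact H]. intros i [Hi|Hi]; [|auto].
    destruct (Nat.eq_dec i m); [auto|left; lia].
Qed.

Lemma fsups_le M n phi (c : R) : forall m (e : nat -> M),
  (forall e' : nat -> M, (forall i, ~ (m <= i < m + n)%nat -> e' i = e i) ->
     fval M phi e' <= c) ->
  fval M (fsups m n phi) e <= c.
Proof.
  induction n as [|n IH]; intros m e H.
  - apply H. auto.
  - apply fsup_le. intros u. apply IH. intros e' He'. apply H. intros i Hi.
    rewrite He' by lia. apply upd_other. lia.
Qed.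

Lemma fsups_ge M n phi : forall m (e e' : nat -> M),
  (forall i, ~ (m <= i < m + n)%nat -> e' i = e i) ->
  fval M phi e' <= fval M (fsups m n phi) e.
Proof.
  induction n as [|n IH]; intros m e e' H.
  - right. simpl. f_equal. apply functional_extensionality. intros i. apply H. lia.
  - simpl fsups. eapply Rle_trans; [|apply (fsup_ge M m _ e (e' m))].
    apply IH. intros i Hi. destruct (Nat.eq_dec i m) as [->|Hx].
    + now rewrite upd_same.
    + rewrite upd_other by auto. apply H. lia.
Qed.

(** Every use of the completeness of [T] goes through this lemma. *)
Lemma transfer (T : Ltheory L) M M' phi psi :
  complete_theory T -> Models M T -> Models M' T ->
  (forall e : nat -> M, fval M phi e <= fval M psi e) ->
  forall e : nat -> M', fval M' phi e <= fval M' psi e.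
Proof.
  intros HT HM HM' H e.
  destruct (formula_bound (fadd phi (fscal (-1) psi))) as [n Hn].
  destruct (HT (fsups 0 n (fadd phi (fscal (-1) psi)))) as [r [Hr _]].
  { apply ffv_fsups. eapply ffv_mono; [|exact Hn]. intros i Hi. left. cbv beta in *. lia. }
  assert (Hr0 : r <= 0).
  { destruct (carrier_inhabited L M) as [m]. rewrite <- (Hr M HM (fun _ => m)).
    apply fsups_le. intros e' _. simpl. specialize (H e'). lra. }
  pose proof (fsups_ge M' n (fadd phi (fscal (-1) psi)) 0 e e) as Hs.
  rewrite (Hr M' HM' e) in Hs. simpl in Hs.
  specialize (Hs (fun i _ => eq_refl)). lra.
Qed.

End Values.

(** * Indicators and the equality pattern of four points *)

Definition ind (P : Prop) : R := if excluded_middle_informative P then 1 else 0.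

Lemma ind_true (P : Prop) : P -> ind P = 1.
Proof. unfold ind. now destruct (excluded_middle_informative P). Qed.

Lemma ind_false (P : Prop) : ~ P -> ind P = 0.
Proof. unfold ind. now destruct (excluded_middle_informative P). Qed.

Lemma ind_cases (P : Prop) : (P /\ ind P = 1) \/ (~ P /\ ind P = 0).
Proof. unfold ind. destruct (excluded_middle_informative P); auto. Qed.

Lemma ind_iff (P Q : Prop) : (P <-> Q) -> ind P = ind Q.
Proof. destruct (ind_cases P), (ind_cases Q); intuition; congruence. Qed.

Lemma ind_bounds (P : Prop) : 0 <= ind P <= 1.
Proof. destruct (ind_cases P); lra. Qed.

Definition wt {A : Type} (w1 w2 w3 w4 : R) (a b c d x : A) : R :=
  w1 * ind (x = a) + w2 * ind (x = b) + w3 * ind (x = c) + w4 * ind (x = d).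

Definition maxwt {A : Type} (w1 w2 w3 w4 : R) (a b c d : A) : R :=
  Rmax (Rmax (wt w1 w2 w3 w4 a b c d a) (wt w1 w2 w3 w4 a b c d b))
       (Rmax (wt w1 w2 w3 w4 a b c d c) (wt w1 w2 w3 w4 a b c d d)).

(** A point different from all four has weight 0, which is harmless for nonnegative weights. *)
Lemma wt_le_maxwt {A : Type} (w1 w2 w3 w4 : R) (a b c d x : A) :
  0 <= w1 -> 0 <= w2 -> 0 <= w3 -> 0 <= w4 ->
  wt w1 w2 w3 w4 a b c d x <= maxwt w1 w2 w3 w4 a b c d.
Proof.
  intros. set (W := wt w1 w2 w3 w4 a b c d).
  assert (Ha : W a <= maxwt w1 w2 w3 w4 a b c d)
    by (unfold maxwt; eapply Rle_trans; [apply Rmax_l|apply Rmax_l]).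
  assert (Hb : W b <= maxwt w1 w2 w3 w4 a b c d)
    by (unfold maxwt; eapply Rle_trans; [apply Rmax_r|apply Rmax_l]).
  assert (Hc : W c <= maxwt w1 w2 w3 w4 a b c d)
    by (unfold maxwt; eapply Rle_trans; [apply Rmax_l|apply Rmax_r]).
  assert (Hd : W d <= maxwt w1 w2 w3 w4 a b c d)
    by (unfold maxwt; eapply Rle_trans; [apply Rmax_r|apply Rmax_r]).
  destruct (classic (x = a)) as [->|Na]; auto.
  destruct (classic (x = b)) as [->|Nb]; auto.
  destruct (classic (x = c)) as [->|Nc]; auto.
  destruct (classic (x = d)) as [->|Nd]; auto.
  apply Rle_trans with (W a); auto. unfold W, wt.
  rewrite (ind_false (x = a)), (ind_false (x = b)), (ind_false (x = c)),
    (ind_false (x = d)) by auto.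
  pose proof (ind_bounds (a = a)). pose proof (ind_bounds (a = b)).
  pose proof (ind_bounds (a = c)). pose proof (ind_bounds (a = d)).
  assert (0 <= w1 * ind (a = a)) by (apply Rmult_le_pos; lra).
  assert (0 <= w2 * ind (a = b)) by (apply Rmult_le_pos; lra).
  assert (0 <= w3 * ind (a = c)) by (apply Rmult_le_pos; lra).
  assert (0 <= w4 * ind (a = d)) by (apply Rmult_le_pos; lra).
  lra.
Qed.

(* [maxwt] is the largest weight of a block of the partition of a, b, c, d given
   by equality; these weights were found by solving the linear system over the
   15 partitions. *)
Lemma ind_two_equalities {A : Type} (a b c d : A) :
  ind (a = b /\ c = d) =
  3 + ind (a = b) + ind (a = c) + ind (a = d) + ind (b = c) + ind (b = d) + ind (c = d)
  - / 2 * (maxwt 2 2 3 1 a b c d + maxwt 2 2 1 3 a b c d).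
Proof.
  unfold maxwt, wt.
  destruct (classic (a = b)); destruct (classic (a = c)); try (exfalso; congruence);
  destruct (classic (a = d)); try (exfalso; congruence);
  destruct (classic (b = c)); try (exfalso; congruence);
  destruct (classic (b = d)); try (exfalso; congruence);
  destruct (classic (c = d)); try (exfalso; congruence);
  repeat match goal with
    | |- context [ind ?P] =>
        first [ rewrite (ind_true P) by (try split; congruence)
              | rewrite (ind_false P) by (intuition congruence) ]
    end;
  unfold Rmax; repeat destruct Rle_dec; lra.
Qed.

(** As lists, tuples are points of a single type, so the identity for four points applies to four
    tuples. *)
Definition tup {A : Type} (n : nat) (u : nat -> A) : list A := map u (seq 0 n).

Lemma tup_eq {A : Type} (n : nat) (u v : nat -> A) :
  tup n u = tup n v <-> forall i, (i < n)%nat -> u i = v i.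
Proof.
  unfold tup. split.
  - intros H i Hi. apply (proj1 map_ext_in_iff H).
    apply in_seq. lia.
  - intros H. apply map_ext_in. intros i Hi. apply H. apply in_seq in Hi. lia.
Qed.

Definition blk {A : Type} (m n : nat) (u e : nat -> A) : nat -> A :=
  fun i => if (Nat.leb m i && Nat.ltb i (m + n))%bool then u (i - m)%nat else e i.

Lemma blk_in {A : Type} m n (u e : nat -> A) i : (i < n)%nat -> blk m n u e (m + i)%nat = u i.
Proof.
  intros H. unfold blk. replace (Nat.leb m (m + i)) with true by (symmetry; apply Nat.leb_le; lia).
  replace (Nat.ltb (m + i) (m + n)) with true by (symmetry; apply Nat.ltb_lt; lia).
  simpl. f_equal. lia.
Qed.

Lemma blk_out {A : Type} m n (u e : nat -> A) i :
  ~ (m <= i < m + n)%nat -> blk m n u e i = e i.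
Proof.
  intros H. unfold blk. destruct (Nat.leb_spec m i); simpl; auto.
  destruct (Nat.ltb_spec i (m + n)); auto. lia.
Qed.

(** * Affine definability in first order models *)

Section Definability.
Context {L : language} (T : Ltheory L).

Definition fo_model_of (M : Lstructure L) : Prop := Models M T /\ first_order_model M.

(** The equation is asked for in first order models only; other models are reached through
    [transfer]. *)
Definition affine_def (f : forall M : Lstructure L, (nat -> M) -> R) : Prop :=
  exists phi, forall M, fo_model_of M -> forall e, fval M phi e = f M e.

Lemma affine_def_ext f g :
  (forall M, fo_model_of M -> forall e, f M e = g M e) -> affine_def f -> affine_def g.
Proof. intros H [phi Hphi]. exists phi. intros. rewrite Hphi by auto. now apply H. Qed.

Lemma affine_def_const c : affine_def (fun M e => c).
Proof. exists (fscal c fone). intros. simpl. lra. Qed.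

Lemma affine_def_add f g :
  affine_def f -> affine_def g -> affine_def (fun M e => f M e + g M e).
Proof.
  intros [p Hp] [q Hq]. exists (fadd p q). intros. simpl. now rewrite Hp, Hq.
Qed.

Lemma affine_def_scal c f : affine_def f -> affine_def (fun M e => c * f M e).
Proof. intros [p Hp]. exists (fscal c p). intros. simpl. now rewrite Hp. Qed.

(** The maximum over the four tuples equals the supremum over all [n]-tuples [x], since no [x]
    weighs more than the heaviest of the four; and the weight of [x] is a linear combination of
    equalities of tuples. *)
Lemma affine_def_maxwt n w1 w2 w3 w4 (a b c d : nat -> nat) :
  (forall a b, affine_def (fun M e =>
     ind (tup n (fun i => e (a i)) = tup n (fun i => e (b i))))) ->
  0 <= w1 -> 0 <= w2 -> 0 <= w3 -> 0 <= w4 ->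
  affine_def (fun M e => maxwt w1 w2 w3 w4
     (tup n (fun i => e (a i))) (tup n (fun i => e (b i)))
     (tup n (fun i => e (c i))) (tup n (fun i => e (d i)))).
Proof.
  intros Heq H1 H2 H3 H4.
  (* The tuple [x] occupies the variables from [m] on, above every index used by the four tuples. *)
  destruct (uniform_bound (fun i m => (a i < m /\ b i < m /\ c i < m /\ d i < m)%nat) n)
    as [m Hm].
  { intros; lia. }
  { intros i. exists (S (a i + b i + c i + d i)). lia. }
  assert (Hw : affine_def (fun M e => wt w1 w2 w3 w4
     (tup n (fun i => e (a i))) (tup n (fun i => e (b i)))
     (tup n (fun i => e (c i))) (tup n (fun i => e (d i)))
     (tup n (fun i => e (m + i)%nat)))).
  { unfold wt. repeat apply affine_def_add; apply affine_def_scal, (Heq (fun i => (m + i)%nat)). }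
  destruct Hw as [phi Hphi]. exists (fsups m n phi). intros M HM e.
  assert (Hout : forall (e' : nat -> M) (a : nat -> nat),
    (forall i, ~ (m <= i < m + n)%nat -> e' i = e i) ->
    (forall i, (i < n)%nat -> (a i < m)%nat) ->
    tup n (fun i => e' (a i)) = tup n (fun i => e (a i))).
  { intros e' a' He' Ha'. apply tup_eq. intros i Hi. apply He'. specialize (Ha' i Hi). lia. }
  assert (Ha : forall i, (i < n)%nat -> (a i < m)%nat) by (intros i Hi; now apply Hm).
  assert (Hb : forall i, (i < n)%nat -> (b i < m)%nat) by (intros i Hi; now apply Hm).
  assert (Hc : forall i, (i < n)%nat -> (c i < m)%nat) by (intros i Hi; now apply Hm).
  assert (Hd : forall i, (i < n)%nat -> (d i < m)%nat) by (intros i Hi; now apply Hm).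
  apply Rle_antisym.
  - apply fsups_le. intros e' He'. rewrite Hphi by auto.
    rewrite (Hout e' a), (Hout e' b), (Hout e' c), (Hout e' d) by auto.
    now apply wt_le_maxwt.
  - assert (Hge : forall u : nat -> M, wt w1 w2 w3 w4
       (tup n (fun i => e (a i))) (tup n (fun i => e (b i)))
       (tup n (fun i => e (c i))) (tup n (fun i => e (d i))) (tup n u)
       <= fval M (fsups m n phi) e).
    { intros u. assert (Hu : forall i, ~ (m <= i < m + n)%nat -> blk m n u e i = e i)
        by (intros; now apply blk_out).
      eapply Rle_trans; [|apply (fsups_ge M n phi m e _ Hu)].
      rewrite Hphi by auto.
      set (e' := blk m n u e) in *.
      rewrite (Hout e' a), (Hout e' b), (Hout e' c), (Hout e' d) by auto.
      right. f_equal. apply tup_eq. intros i Hi. unfold e'. now rewrite blk_in. }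
    unfold maxwt. repeat apply Rmax_lub; apply Hge.
Qed.

Lemma affine_def_two_equalities n (a b c d : nat -> nat) :
  (forall a b, affine_def (fun M e =>
     ind (tup n (fun i => e (a i)) = tup n (fun i => e (b i))))) ->
  affine_def (fun M e => ind (tup n (fun i => e (a i)) = tup n (fun i => e (b i)) /\
                              tup n (fun i => e (c i)) = tup n (fun i => e (d i)))).
Proof.
  intros H. eapply affine_def_ext.
  { intros M HM e. symmetry. apply ind_two_equalities. }
  unfold Rminus. apply affine_def_add; [do 6 (apply affine_def_add; auto)|].
  - apply affine_def_const.
  - pose proof (affine_def_maxwt n 2 2 3 1 a b c d H
      ltac:(lra) ltac:(lra) ltac:(lra) ltac:(lra)) as K1.
    pose proof (affine_def_maxwt n 2 2 1 3 a b c d H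
      ltac:(lra) ltac:(lra) ltac:(lra) ltac:(lra)) as K2.
    eapply affine_def_ext; [|exact (affine_def_scal (- / 2) _ (affine_def_add _ _ K1 K2))].
    intros M HM e. cbv beta. ring.
Qed.

Lemma affine_def_eq t1 t2 :
  affine_def (fun M e => ind (teval M t1 e = teval M t2 e)).
Proof.
  exists (fadd fone (fscal (-1) (fdist t1 t2))). intros M [_ [HM _]] e. simpl.
  destruct (ind_cases (teval M t1 e = teval M t2 e)) as [[H ->]|[H ->]].
  - rewrite H, dist_refl. lra.
  - destruct (HM (teval M t1 e) (teval M t2 e)) as [H0|H0]; [|lra].
    apply dist_sep in H0. contradiction.
Qed.

(* In the step from [n+1] to [n+2] the new coordinate is compared as a constant
   [(n+1)]-tuple. *)
Lemma affine_def_tuple_eq n : forall a b, affine_def (fun M e =>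
  ind (tup n (fun i => e (a i)) = tup n (fun i => e (b i)))).
Proof.
  induction n as [|[|n] IH]; intros a b.
  - eapply affine_def_ext; [|apply (affine_def_const 1)].
    intros M HM e. symmetry. now apply ind_true.
  - eapply affine_def_ext; [|apply (affine_def_eq (tvar (a 0%nat)) (tvar (b 0%nat)))].
    intros M HM e. apply ind_iff. rewrite tup_eq. simpl. split.
    + intros H i Hi. now replace i with 0%nat by lia.
    + intros H. apply H. lia.
  - eapply affine_def_ext; [|apply (affine_def_two_equalities (S n)
      (fun _ => a (S n)) (fun _ => b (S n)) a b IH)].
    intros M HM e. apply ind_iff. rewrite !tup_eq. split.
    + intros [H1 H2] i Hi. destruct (Nat.eq_dec i (S n)) as [->|].
      * apply (H1 0%nat). lia.
      * apply H2. lia.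
    + intros H. split; intros i Hi; apply H; lia.
Qed.

Section Complete.
Hypothesis HT : complete_theory T.
Context (M0 : Lstructure L) (HM0 : fo_model_of M0).

Lemma affine_def_and (P Q : forall M : Lstructure L, (nat -> M) -> Prop) :
  affine_def (fun M e => ind (P M e)) -> affine_def (fun M e => ind (Q M e)) ->
  affine_def (fun M e => ind (P M e /\ Q M e)).
Proof.
  intros [p Hp] [q Hq].
  destruct (classic (exists e : nat -> M0, P M0 e /\ Q M0 e)) as [[e0 [HP0 HQ0]]|Hno].
  (* If [P] and [Q] excluded each other in [M], then [p + q <= 1] would hold there and hence in
     [M0], against [e0]. *)
  - assert (Hex : forall M, fo_model_of M -> exists e : nat -> M, P M e /\ Q M e).
    { intros M HM. apply NNPP. intros Hno.
      assert (fval M0 (fadd p q) e0 <= fval M0 fone e0).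
      { apply (transfer T M M0 _ _ HT (proj1 HM) (proj1 HM0)).
        intros e. simpl. rewrite Hp, Hq by auto.
        destruct (ind_cases (P M e)) as [[H1 ->]|[H1 ->]];
        destruct (ind_cases (Q M e)) as [[H2 ->]|[H2 ->]]; try lra.
        exfalso. eauto. }
      simpl in H. rewrite Hp, Hq, !ind_true in H by auto. lra. }
    destruct (formula_bound p) as [n1 Hn1], (formula_bound q) as [n2 Hn2].
    set (n := Nat.max n1 n2).
    (* [P] and [Q] are arbitrary predicates; that they depend on the first [n] variables only is
       read off from [p] and [q]. *)
    assert (HPl : forall M, fo_model_of M -> forall e e' : nat -> M,
      (forall i, (i < n)%nat -> e i = e' i) -> ind (P M e) = ind (P M e')).
    { intros M HM e e' He. rewrite <- !Hp by auto. eapply fval_local; [exact Hn1|].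
      intros i Hi. apply He. cbv beta in Hi. lia. }
    assert (HQl : forall M, fo_model_of M -> forall e e' : nat -> M,
      (forall i, (i < n)%nat -> e i = e' i) -> ind (Q M e) = ind (Q M e')).
    { intros M HM e e' He. rewrite <- !Hq by auto. eapply fval_local; [exact Hn2|].
      intros i Hi. apply He. cbv beta in Hi. lia. }
    destruct (affine_def_tuple_eq n (fun i => i) (fun i => (n + i)%nat)) as [th Hth].
    destruct (subst_exists p (fun i => tvar (n + i)%nat)) as [p' Hp'].
    destruct (subst_exists q (fun i => tvar (n + i)%nat)) as [q' Hq'].
    exists (fsups n n (fadd (fadd th (fadd p' q')) (fscal (-2) fone))).
    intros M HM e.
    assert (Hval : forall e' : nat -> M,
      fval M (fadd (fadd th (fadd p' q')) (fscal (-2) fone)) e' =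
      ind (tup n e' = tup n (fun i => e' (n + i)%nat)) +
      (ind (P M (fun i => e' (n + i)%nat)) + ind (Q M (fun i => e' (n + i)%nat))) - 2).
    { intros e'. simpl. rewrite Hth, Hp', Hq' by auto. simpl. rewrite Hp, Hq by auto.
      change (fun i => e' i) with e'. lra. }
    apply Rle_antisym.
    + apply fsups_le. intros e' He'. rewrite Hval.
      destruct (ind_cases (tup n e' = tup n (fun i => e' (n + i)%nat))) as [[H1 ->]|[H1 ->]].
      * rewrite tup_eq in H1.
        assert (Hee : forall i, (i < n)%nat -> e' (n + i)%nat = e i)
          by (intros i Hi; rewrite <- H1 by auto; apply He'; lia).
        rewrite (HPl M HM _ e Hee), (HQl M HM _ e Hee).
        destruct (ind_cases (P M e)) as [[H2 ->]|[H2 ->]];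
        destruct (ind_cases (Q M e)) as [[H3 ->]|[H3 ->]];
        destruct (ind_cases (P M e /\ Q M e)) as [[H4 ->]|[H4 ->]]; try lra; tauto.
      * pose proof (ind_bounds (P M (fun i => e' (n + i)%nat))).
        pose proof (ind_bounds (Q M (fun i => e' (n + i)%nat))).
        pose proof (ind_bounds (P M e /\ Q M e)). lra.
    + assert (Hge : forall u : nat -> M,
        ind (tup n e = tup n u) + (ind (P M u) + ind (Q M u)) - 2 <=
        fval M (fsups n n (fadd (fadd th (fadd p' q')) (fscal (-2) fone))) e).
      { intros u. assert (Hu : forall i, ~ (n <= i < n + n)%nat -> blk n n u e i = e i)
          by (intros; now apply blk_out).
        eapply Rle_trans; [|apply (fsups_ge M n _ n e _ Hu)]. rewrite Hval.
        assert (Hin : forall i, (i < n)%nat -> blk n n u e (n + i)%nat = u i)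
          by (intros; now apply blk_in).
        rewrite (HPl M HM _ u Hin), (HQl M HM _ u Hin).
        replace (tup n (blk n n u e)) with (tup n e)
          by (apply tup_eq; intros i Hi; rewrite Hu by lia; reflexivity).
        replace (tup n (fun i => blk n n u e (n + i)%nat)) with (tup n u)
          by (apply tup_eq; intros i Hi; now rewrite Hin). lra. }
      (* Take [u = e] if both hold at [e], and otherwise a witness from [Hex], which contributes at
         least 0. *)
      destruct (ind_cases (P M e /\ Q M e)) as [[[H1 H2] ->]|[H1 ->]].
      * specialize (Hge e). rewrite !ind_true in Hge by auto. lra.
      * destruct (Hex M HM) as [u [HPu HQu]]. specialize (Hge u).
        rewrite (ind_true (P M u)), (ind_true (Q M u)) in Hge by auto.
        pose proof (ind_bounds (tup n e = tup n u)). lra.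
  (* Without a common witness [p + q <= 1] holds in [M0], hence in [M], so the conjunction is never
     true. *)
  - exists (fscal 0 fone). intros M HM e. simpl.
    rewrite ind_false; [lra|]. intros [H1 H2].
    assert (fval M (fadd p q) e <= fval M fone e).
    { apply (transfer T M0 M _ _ HT (proj1 HM0) (proj1 HM)).
      intros e'. simpl. rewrite Hp, Hq by auto.
      destruct (ind_cases (P M0 e')) as [[H3 ->]|[H3 ->]];
      destruct (ind_cases (Q M0 e')) as [[H4 ->]|[H4 ->]]; try lra.
      exfalso. eauto. }
    simpl in H. rewrite Hp, Hq, !ind_true in H by auto. lra.
Qed.

Lemma affine_def_not (P : forall M : Lstructure L, (nat -> M) -> Prop) :
  affine_def (fun M e => ind (P M e)) -> affine_def (fun M e => ind (~ P M e)).
Proof.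
  intros H. eapply affine_def_ext;
    [|apply affine_def_add; [apply (affine_def_const 1)|apply (affine_def_scal (-1)), H]].
  intros M HM e. simpl.
  destruct (ind_cases (P M e)) as [[H1 ->]|[H1 ->]];
  destruct (ind_cases (~ P M e)) as [[H2 ->]|[H2 ->]]; try lra; tauto.
Qed.

Lemma affine_def_ex x (P : forall M : Lstructure L, (nat -> M) -> Prop) :
  affine_def (fun M e => ind (P M e)) ->
  affine_def (fun M e => ind (exists m : M, P M (upd e x m))).
Proof.
  intros [p Hp]. exists (fsup x p). intros M HM e.
  destruct (ind_cases (exists m : M, P M (upd e x m))) as [[[m H1] ->]|[H1 ->]];
  apply Rle_antisym.
  - apply fsup_le. intros m'. rewrite Hp by auto. apply ind_bounds.
  - eapply Rle_trans; [|apply (fsup_ge M x p e m)]. rewrite Hp, ind_true by auto. lra.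
  - apply fsup_le. intros m'. rewrite Hp, ind_false by (auto; eauto). lra.
  - destruct (carrier_inhabited L M) as [m].
    eapply Rle_trans; [|apply (fsup_ge M x p e m)]. rewrite Hp by auto. apply ind_bounds.
Qed.

(** * First order formulas are affine *)

Lemma FRint_one_local (M : Lstructure L) r (a b : nat -> M) :
  (forall i, (i < rarity L r)%nat -> a i = b i) -> (Rint M r a = 1 <-> Rint M r b = 1).
Proof. intros H. now rewrite (Rint_local M r a b H). Qed.

Definition fo_of (M : Lstructure L) : FOstructure L := {|
  fcarrier := M;
  fcarrier_inhabited := carrier_inhabited L M;
  FFint := Fint M;
  FRint := fun r a => Rint M r a = 1;
  FFint_local := Fint_local M;
  FRint_local := FRint_one_local M
|}.

Lemma fteval_fo_of (M : Lstructure L) t (e : nat -> M) :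
  fteval (fo_of M) t e = teval M t e.
Proof.
  induction t as [i|f ts IH]; simpl; auto. f_equal. now apply functional_extensionality.
Qed.

Lemma affine_def_fsat (s : fformula L) :
  affine_def (fun M e => ind (fsat (fo_of M) s e)).
Proof.
  induction s as [ |t1 t2|r ts|p IH|p IHp q IHq|p IHp q IHq|p IHp q IHq|x p IH|x p IH].
  - eapply affine_def_ext; [|apply (affine_def_const 0)].
    intros M HM e. symmetry. now apply ind_false.
  - eapply affine_def_ext; [|apply (affine_def_eq t1 t2)].
    intros M HM e. simpl. now rewrite !fteval_fo_of.
  - exists (fatom r ts). intros M [_ [_ HM]] e. simpl.
    replace (fun i => fteval (fo_of M) (ts i) e) with (fun i => teval M (ts i) e)
      by (apply functional_extensionality; intros i; now rewrite fteval_fo_of).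
    destruct (HM r (fun i => teval M (ts i) e)) as [H|H].
    + rewrite ind_false; [auto|]. lra.
    + now rewrite ind_true.
  - now apply affine_def_not.
  - apply affine_def_and; auto.
  - eapply affine_def_ext; [|apply affine_def_not, affine_def_and;
      [apply affine_def_not, IHp|apply affine_def_not, IHq]].
    intros M HM e. apply ind_iff. simpl. tauto.
  - eapply affine_def_ext; [|apply affine_def_not, affine_def_and;
      [apply IHp|apply affine_def_not, IHq]].
    intros M HM e. apply ind_iff. simpl. tauto.
  - eapply affine_def_ext; [|apply affine_def_not, (affine_def_ex x), affine_def_not, IH].
    intros M HM e. apply ind_iff. simpl. split.
    + intros H m. apply NNPP. intros Hm. apply H. now exists m.
    + intros H [m Hm]. apply Hm, H.
  - apply (affine_def_ex x _ IH).
Qed.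

(** Validity of [s] is the affine inequality [1 <= p], where [p] defines the indicator of [s]. *)
Lemma fsat_transfer (s : fformula L) (M : Lstructure L) :
  fo_model_of M -> (forall e, fsat (fo_of M0) s e) -> forall e, fsat (fo_of M) s e.
Proof.
  intros HM H e. destruct (affine_def_fsat s) as [p Hp].
  assert (fval M fone e <= fval M p e).
  { apply (transfer T M0 M _ _ HT (proj1 HM0) (proj1 HM)).
    intros e'. rewrite Hp, ind_true by auto. simpl. lra. }
  rewrite Hp in H0 by auto. destruct (ind_cases (fsat (fo_of M) s e)) as [[H1 _]|[_ H1]]; auto.
  rewrite H1 in H0. simpl in H0. lra.
Qed.
End Complete.
End Definability.

(** * Affine formulas are first order *)

Section FirstOrder.
Context {L : language}.

(** Ranges over all first order structures, so that it applies to [discrete_structure] before that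
    is known to be a model of [T]. *)
Definition fo_def (P : forall M : Lstructure L, (nat -> M) -> Prop) : Prop :=
  exists s, forall M, first_order_model M -> forall e, fsat (fo_of M) s e <-> P M e.

Lemma fo_def_ext P Q :
  (forall M, first_order_model M -> forall e, P M e <-> Q M e) -> fo_def P -> fo_def Q.
Proof. intros H [s Hs]. exists s. intros M HM e. rewrite Hs by auto. now apply H. Qed.

Lemma fo_def_const (C : Prop) : fo_def (fun M e => C).
Proof.
  destruct (classic C).
  - exists (Fneg L (Ffalse L)). simpl. tauto.
  - exists (Ffalse L). simpl. tauto.
Qed.

Lemma fo_def_not P : fo_def P -> fo_def (fun M e => ~ P M e).
Proof. intros [s Hs]. exists (Fneg L s). intros. simpl. now rewrite Hs. Qed.

Lemma fo_def_and P Q : fo_def P -> fo_def Q -> fo_def (fun M e => P M e /\ Q M e).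
Proof. intros [s Hs] [t Ht]. exists (Fand L s t). intros. simpl. now rewrite Hs, Ht. Qed.

Lemma fo_def_ex x P : fo_def P -> fo_def (fun M e => exists m : M, P M (upd e x m)).
Proof.
  intros [s Hs]. exists (Fex L x s). intros M HM e. simpl.
  split; intros [m Hm]; exists m; now apply Hs.
Qed.

Lemma fo_def_list {A : Type} (V : list A) (P : A -> forall M : Lstructure L, (nat -> M) -> Prop) :
  (forall v, fo_def (P v)) -> fo_def (fun M e => exists v, In v V /\ P v M e).
Proof.
  intros HP. induction V as [|v V [s Hs]].
  - eapply fo_def_ext; [|apply (fo_def_const False)]. intros M HM e. simpl. firstorder.
  - destruct (HP v) as [t Ht]. exists (For L t s). intros M HM e. simpl.
    rewrite Hs, Ht by auto. split.
    + intros [H|[w [Hw H]]]; eauto.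
    + intros [w [[->|Hw] H]]; eauto.
Qed.

(** A list [V] common to all first order structures turns a statement about the value into a finite
    disjunction. Arbitrary sets [A] make the induction close: scaling and addition lead to the
    preimages of [A] under [y |-> c y] and [y |-> v + y]. *)
Definition finitely_valued (phi : formula L) : Prop :=
  exists V : list R,
    (forall M, first_order_model M -> forall e, In (fval M phi e) V) /\
    forall A : R -> Prop, fo_def (fun M e => A (fval M phi e)).

Lemma finite_max (V : list R) : forall P : R -> Prop,
  (exists y, P y) -> (forall y, P y -> In y V) -> exists y, P y /\ forall z, P z -> z <= y.
Proof.
  induction V as [|v V IH]; intros P [y Hy] HV.
  - now apply HV in Hy.
  - destruct (classic (exists z, P z /\ v < z)) as [[z [Hz Hvz]]|Hno].
    + destruct (IH (fun z => P z /\ v < z)) as [w [[Hw Hvw] Hmax]].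
      * now exists z.
      * intros u [Hu Hvu]. destruct (HV u Hu); [lra|auto].
      * exists w. split; auto. intros u Hu.
        destruct (Rlt_le_dec v u); [auto|lra].
    + assert (Hle : forall z, P z -> z <= v).
      { intros z Hz. destruct (Rlt_le_dec v z); auto. exfalso. eauto. }
      destruct (classic (P v)) as [Hv|Hv]; [eauto|].
      apply IH; [eauto|]. intros z Hz. destruct (HV z Hz); [congruence|auto].
Qed.

Lemma fsup_attained (V : list R) x phi (M : Lstructure L) (e : nat -> M) :
  (forall e : nat -> M, In (fval M phi e) V) ->
  exists m, fval M (fsup x phi) e = fval M phi (upd e x m) /\
    forall m', fval M phi (upd e x m') <= fval M phi (upd e x m).
Proof.
  intros HV. destruct (finite_max V (fun y => exists m : M, y = fval M phi (upd e x m)))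
    as [y [[m ->] Hmax]].
  - destruct (carrier_inhabited L M) as [m]. now exists (fval M phi (upd e x m)), m.
  - intros y [m ->]. apply HV.
  - assert (Hm : forall m', fval M phi (upd e x m') <= fval M phi (upd e x m))
      by (intros m'; apply Hmax; now exists m').
    exists m. split; auto. apply Rle_antisym; [now apply fsup_le|apply fsup_ge].
Qed.

Lemma finitely_valued_scal c phi : finitely_valued phi -> finitely_valued (fscal c phi).
Proof.
  intros [V [HV HA]]. exists (map (Rmult c) V). split.
  - intros M HM e. simpl. apply in_map. now apply HV.
  - intros A. apply (HA (fun v => A (c * v))).
Qed.

Lemma finitely_valued_sup x phi : finitely_valued phi -> finitely_valued (fsup x phi).
Proof.
  intros [V [HV HA]]. exists V. split.
  - intros M HM e. destruct (fsup_attained V x phi M e (HV M HM)) as [m [-> _]]. now apply HV.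
  (* With finitely many values the supremum is attained: it is the value that no other value
     exceeds. *)
  - intros A. apply (fo_def_ext (fun M e => exists v, In v V /\ (A v /\
      ((exists m, fval M phi (upd e x m) = v) /\ ~ (exists m, fval M phi (upd e x m) > v))))).
    + intros M HM e. destruct (fsup_attained V x phi M e (HV M HM)) as [m [Hm Hmax]].
      split.
      * intros [v [_ [Hv [[m1 H1] H2]]]]. replace (fval M (fsup x phi) e) with v; auto.
        rewrite Hm, <- H1. apply Rle_antisym; [apply Hmax|].
        apply Rnot_lt_le. intros H3. apply H2. exists m. rewrite <- H1. exact H3.
      * intros Hv. exists (fval M (fsup x phi) e). rewrite Hm in *. repeat split; auto.
        -- now exists m.
        -- intros [m' Hm']. specialize (Hmax m'). lra.
    + apply fo_def_list. intros v. repeat apply fo_def_and.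
      * apply fo_def_const.
      * apply (fo_def_ex x (fun M e => fval M phi e = v)), (HA (fun y => y = v)).
      * apply fo_def_not, (fo_def_ex x (fun M e => fval M phi e > v)), (HA (fun y => y > v)).
Qed.

Lemma formula_finitely_valued phi : finitely_valued phi.
Proof.
  induction phi as [ |r ts|t1 t2|c p IH|p [V [HV HA]] q [W [HW HB]]|x p IH|x p IH].
  - exists (1 :: nil). split; [intros; simpl; auto|].
    intros A. apply (fo_def_const (A 1)).
  - exists (0 :: 1 :: nil). split.
    + intros M [_ HM] e. simpl. destruct (HM r (fun i => teval M (ts i) e)); auto.
    + intros A.
      assert (Hr : fo_def (fun M e => Rint M r (fun i => teval M (ts i) e) = 1)).
      { exists (Frel L r ts). intros M HM e. simpl.
        replace (fun i => fteval (fo_of M) (ts i) e) with (fun i => teval M (ts i) e)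
          by (apply functional_extensionality; intros i; now rewrite fteval_fo_of).
        tauto. }
      (* Disjunction over the two possible values 1 and 0, in De Morgan form. *)
      apply (fo_def_ext (fun M e => 
        ~ (~ (Rint M r (fun i => teval M (ts i) e) = 1 /\ A 1) /\
           ~ (~ Rint M r (fun i => teval M (ts i) e) = 1 /\ A 0)))).
      * intros M [_ HM] e. simpl. destruct (HM r (fun i => teval M (ts i) e)) as [-> | ->].
        -- destruct (classic (A 0)); intuition lra.
        -- destruct (classic (A 1)); intuition lra.
      * repeat first [apply fo_def_and|apply fo_def_not|apply Hr|apply fo_def_const].
  - exists (0 :: 1 :: nil). split.
    + intros M [HM _] e. simpl. destruct (HM (teval M t1 e) (teval M t2 e)); auto.
    + intros A.
      assert (Hr : fo_def (fun M e => teval M t1 e = teval M t2 e)).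
      { exists (Feq L t1 t2). intros M HM e. simpl. now rewrite !fteval_fo_of. }
      apply (fo_def_ext (fun M e => 
        ~ (~ (teval M t1 e = teval M t2 e /\ A 0) /\
           ~ (~ teval M t1 e = teval M t2 e /\ A 1)))).
      * intros M [HM _] e. simpl. destruct (classic (teval M t1 e = teval M t2 e)) as [H|H].
        -- rewrite H, dist_refl. tauto.
        -- destruct (HM (teval M t1 e) (teval M t2 e)) as [H0|H0].
           ++ apply dist_sep in H0. contradiction.
           ++ rewrite H0. tauto.
      * repeat first [apply fo_def_and|apply fo_def_not|apply Hr|apply fo_def_const].
  - now apply finitely_valued_scal.
  - exists (map (fun vw => fst vw + snd vw) (list_prod V W)). split.
    + intros M HM e. apply in_map_iff. exists (fval M p e, fval M q e). split; auto.
      apply in_prod; auto.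
    + intros A. apply (fo_def_ext (fun M e => exists v, In v V /\
        (fval M p e = v /\ A (v + fval M q e)))).
      * intros M HM e. simpl. split.
        -- intros [v [_ [-> H]]]. exact H.
        -- intros H. exists (fval M p e). auto.
      * apply fo_def_list. intros v. apply fo_def_and.
        -- apply (HA (fun y => y = v)).
        -- apply (HB (fun y => A (v + y))).
  - assert (H : finitely_valued (fscal (-1) (fsup x (fscal (-1) p))))
      by now apply finitely_valued_scal, finitely_valued_sup, finitely_valued_scal.
    destruct H as [V [HV HA]].
    assert (Heq : forall (M : Lstructure L) e, fval M (finf x p) e =
      fval M (fscal (-1) (fsup x (fscal (-1) p))) e).
    { intros M e. rewrite finf_opp. change (fval M (fscal (-1) (fsup x (fscal (-1) p))) e)
        with (-1 * fval M (fsup x (fscal (-1) p)) e). lra. }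
    exists V. split.
    + intros M HM e. rewrite Heq. auto.
    + intros A. eapply fo_def_ext; [|apply (HA A)]. intros M HM e. now rewrite Heq.
  - now apply finitely_valued_sup.
Qed.
End FirstOrder.

(** * Products of affine formulas with events *)

Section Theory.
Context {L : language} (T : Ltheory L) (HT : complete_theory T).
Context (M0 : Lstructure L) (HM0 : fo_model_of T M0).

Lemma affine_def_of_fo_def P : fo_def P -> affine_def T (fun M e => ind (P M e)).
Proof.
  intros [s Hs]. eapply affine_def_ext; [|apply (affine_def_fsat T HT M0 HM0 s)].
  intros M HM e. apply ind_iff. apply Hs, HM.
Qed.

(** In first order models the product is the sum over the values [v] of [phi] of [v
    [phi = v and rho = 1]], and these indicators are first order, hence affine. *)
Lemma affine_def_mult phi rho :
  (forall M, first_order_model M -> forall e, fval M rho e = 0 \/ fval M rho e = 1) ->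
  affine_def T (fun M e => fval M phi e * fval M rho e).
Proof.
  intros Hrho. destruct (formula_finitely_valued phi) as [V [HV HA]].
  destruct (formula_finitely_valued rho) as [_ [_ HB]].
  (* Induction over a list [W] of values; the clause [~ In (fval M phi e) W] keeps a repeated entry
     from being counted twice. *)
  assert (H : forall W : list R, affine_def T (fun M e =>
    fval M phi e * ind (In (fval M phi e) W /\ fval M rho e = 1))).
  { intros W. induction W as [|v W IH].
    - eapply affine_def_ext; [|apply (affine_def_const T 0)]. intros M HM e. cbv beta.
      rewrite ind_false; [lra|]. simpl. tauto.
    - eapply affine_def_ext; [|apply affine_def_add; [exact IH|
        apply (affine_def_scal T v), (affine_def_of_fo_def (fun M e =>
          (fval M phi e = v /\ ~ In (fval M phi e) W) /\ fval M rho e = 1)), fo_def_and;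
          [apply (HA (fun y => y = v /\ ~ In y W))|apply (HB (fun y => y = 1))]]].
      intros M HM e. cbv beta.
      destruct (classic (fval M rho e = 1)) as [H1|H1].
      2: { rewrite !ind_false by tauto. lra. }
      destruct (classic (In (fval M phi e) W)) as [H2|H2].
      + rewrite ind_true by tauto. rewrite ind_false by tauto. rewrite ind_true; [lra|].
        simpl. tauto.
      + rewrite ind_false by tauto. destruct (classic (fval M phi e = v)) as [H3|H3].
        * rewrite ind_true by tauto. rewrite ind_true; [rewrite H3; lra|].
          split; [left; congruence|tauto].
        * rewrite ind_false by tauto. rewrite ind_false; [lra|].
          intros [[H4|H4] _]; [congruence|tauto]. }
  eapply affine_def_ext; [|apply (H V)]. intros M [HM1 HM2] e. cbv beta. f_equal.
  destruct (Hrho M HM2 e) as [-> | ->].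
  - apply ind_false. lra.
  - apply ind_true. split; auto.
Qed.

(** * First order models are extremal *)

(** Types are compared on formulas in [n] variables, whereas a defining formula may carry others.
    Suprema over those remove them and leave the value alone, as [f] does not depend on them. *)
Lemma formula_in_of_local f n :
  affine_def T f ->
  (forall M, fo_model_of T M -> forall e e' : nat -> M,
     (forall i, (i < n)%nat -> e i = e' i) -> f M e = f M e') ->
  exists phi, formula_in L n phi /\
    forall M, fo_model_of T M -> forall e, fval M phi e = f M e.
Proof.
  intros [p Hp] Hf. destruct (formula_bound p) as [k Hk].
  exists (fsups n k p). split.
  - apply ffv_fsups. eapply ffv_mono; [|exact Hk]. intros i Hi. cbv beta in *. lia.
  - intros M HM e. apply Rle_antisym.
    + apply fsups_le. intros e' He'. rewrite Hp by auto. right. apply Hf; auto.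
      intros i Hi. apply He'. lia.
    + rewrite <- Hp by auto. now apply fsups_ge.
Qed.

Lemma fo_model_extremal (M : Lstructure L) : fo_model_of T M -> extremal T M.
Proof.
  intros HM n a. split.
  { exists M, a. split; [apply HM|reflexivity]. }
  intros q r t [N1 [b1 [HN1 Hq]]] [N2 [b2 [HN2 Hr]]] Ht Hmix phi Hphi.
  set (v0 := fval M phi a).
  destruct (formula_finitely_valued phi) as [V [HV HA]].
  destruct (formula_in_of_local (fun M e => ind (fval M phi e = v0)) n) as [chi [Hchi Hc]].
  { apply affine_def_of_fo_def, (HA (fun y => y = v0)). }
  { intros M' HM' e e' He. now rewrite (fval_local M' phi _ e e' Hphi He). }
  destruct (fval_bounded M phi) as [B HB].
  assert (HB0 : 0 <= B) by (eapply Rle_trans; [apply Rabs_pos|apply (HB a)]).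
  assert (Hone : forall (N : Lstructure L) (b : nat -> N), Models N T -> fval N chi b <= 1).
  { intros N b HN. change 1 with (fval N fone b).
    apply (transfer T M N _ _ HT (proj1 HM) HN). intros e. rewrite Hc by auto. apply ind_bounds. }
  (* In [M] both [phi] and [v0] lie in [[-B, B]] and [chi] is the indicator of [phi = v0], so
     [|phi - v0| <= 2 B (1 - chi)]. These are two affine inequalities, which pass to [N]. *)
  assert (Hval : forall (N : Lstructure L) (b : nat -> N), Models N T -> fval N chi b = 1 -> fval N phi b = v0).
  { intros N b HN Hb.
    assert (H1 : fval N phi b <=
      fval N (fadd (fscal (v0 + 2 * B) fone) (fscal (- (2 * B)) chi)) b).
    { apply (transfer T M N _ _ HT (proj1 HM) HN). intros e. simpl. rewrite Hc by auto.
      pose proof (HB e) as He. pose proof (HB a) as Ha. apply Rabs_le_between in He.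
      apply Rabs_le_between in Ha. fold v0 in Ha.
      destruct (ind_cases (fval M phi e = v0)) as [[H ->]|[H ->]]; lra. }
    assert (H2 : fval N (fadd (fscal (v0 - 2 * B) fone) (fscal (2 * B) chi)) b <= fval N phi b).
    { apply (transfer T M N _ _ HT (proj1 HM) HN). intros e. simpl. rewrite Hc by auto.
      pose proof (HB e) as He. pose proof (HB a) as Ha. apply Rabs_le_between in He.
      apply Rabs_le_between in Ha. fold v0 in Ha.
      destruct (ind_cases (fval M phi e = v0)) as [[H ->]|[H ->]]; lra. }
    simpl in H1, H2. rewrite Hb in H1, H2. lra. }
  pose proof (Hmix chi Hchi) as Hm. unfold tp in Hm. rewrite Hc, ind_true in Hm by auto.
  rewrite (Hq chi Hchi), (Hr chi Hchi) in Hm. unfold tp in Hm.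
  pose proof (Hone N1 b1 HN1) as H1. pose proof (Hone N2 b2 HN2) as H2.
  (* A proper convex combination of two numbers that are at most 1 equals 1 only if both do. *)
  assert (E1 : fval N1 chi b1 = 1) by nra.
  assert (E2 : fval N2 chi b2 = 1) by nra.
  rewrite (Hq phi Hphi), (Hr phi Hphi). unfold tp.
  now rewrite (Hval N1 b1 HN1 E1), (Hval N2 b2 HN2 E2).
Qed.

(** * Conditioning a model on an event *)

Definition fsum (n : nat) (g : nat -> formula L) : formula L :=
  nat_rect (fun _ => formula L) (fscal 0 fone) (fun i p => fadd p (g i)) n.

Lemma fval_fsum (M : Lstructure L) n g (e : nat -> M) :
  fval M (fsum n g) e = sumR n (fun i => fval M (g i) e).
Proof. induction n; simpl; [lra|]. now rewrite IHn. Qed.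

Lemma supM_eq {A B : Type} (f : A -> R) (g : B -> R) :
  (forall a, exists b, f a = g b) -> (forall b, exists a, f a = g b) -> supM f = supM g.
Proof.
  intros H1 H2. unfold supM. f_equal. apply Lub_Rbar_eqset. intros y. split.
  - intros [a ->]. apply H1.
  - intros [b ->]. destruct (H2 b) as [a Ha]. now exists a.
Qed.

(* Elements of a model behave like random variables with values in a first order
   model.  Conditioning on the event [rho(a)] rescales the part of the metric that
   lives on the event; a complete set of representatives is given by the elements
   which agree with a fixed [v] off the event.  In first order models [pi phi] is
   [phi * rho], with [rho] read at the first [n] variables and [phi] at the
   remaining ones; [on phi b] is then "the integral of [phi(b)] over the event". *)
Section Conditioning.
Context (M : Lstructure L) (HM : Models M T) (n : nat) (a : nat -> M).
Context (rho : formula L) (Hn : formula_in L n rho).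
Context (H01 : forall e : nat -> M0, fval M0 rho e = 0 \/ fval M0 rho e = 1).
Context (Hw : 0 < fval M rho a).
Context (pi : formula L -> formula L).
Context (Hpi : forall phi (e : nat -> M0),
  fval M0 (pi phi) e = fval M0 phi (fun i => e (n + i)%nat) * fval M0 rho e).

Let w := fval M rho a.

Definition join (b : nat -> M) : nat -> M :=
  fun i => if Nat.ltb i n then a i else b (i - n)%nat.

Lemma join_lt b i : (i < n)%nat -> join b i = a i.
Proof. unfold join. intros H. now apply Nat.ltb_lt in H as ->. Qed.

Lemma join_ge b i : join b (n + i)%nat = b i.
Proof.
  unfold join. destruct (Nat.ltb_spec (n + i) n); [lia|]. f_equal. lia.
Qed.

Lemma join_upd b x m : upd (join b) (n + x) m = join (upd b x m).
Proof.
  apply functional_extensionality. intros i. destruct (Nat.lt_ge_cases i n) as [Hi|Hi].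
  - rewrite upd_other by lia. now rewrite !join_lt.
  - replace i with (n + (i - n))%nat by lia. rewrite join_ge.
    destruct (Nat.eq_dec (i - n) x) as [<-|Hx].
    + now rewrite !upd_same.
    + rewrite !upd_other by lia. apply join_ge.
Qed.

Lemma join_shift b : (fun i => join b (n + i)%nat) = b.
Proof. apply functional_extensionality. intros i. apply join_ge. Qed.

Definition on (phi : formula L) (b : nat -> M) : R := fval M (pi phi) (join b).
Definition off (phi : formula L) (b : nat -> M) : R := fval M phi b - on phi b.

Lemma rho_nonneg (e : nat -> M0) : 0 <= fval M0 rho e <= 1.
Proof. destruct (H01 e) as [-> | ->]; lra. Qed.

(** [pi] is known only through its values in [M0]. An equality there amounts to two affine
    inequalities and so holds in [M]; linearity, suprema and substitution for [on] are all obtained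
    this way. *)
Lemma on_eq phi psi b :
  (forall e : nat -> M0, fval M0 (pi phi) e = fval M0 psi e) ->
  on phi b = fval M psi (join b).
Proof.
  intros H. apply Rle_antisym; apply (transfer T M0 M _ _ HT (proj1 HM0) HM);
  intros e; rewrite H; lra.
Qed.

Lemma on_mono phi psi b :
  (forall e : nat -> M0, fval M0 phi e <= fval M0 psi e) -> on phi b <= on psi b.
Proof.
  intros H. apply (transfer T M0 M _ _ HT (proj1 HM0) HM). intros e. rewrite !Hpi.
  apply Rmult_le_compat_r; [apply rho_nonneg|apply H].
Qed.

(** Rests on [1 - rho] being nonnegative in [M0]; [phi'] moves [phi] to the variables from [n] on,
    where [pi phi] reads it. *)
Lemma off_mono phi psi b :
  (forall e : nat -> M0, fval M0 phi e <= fval M0 psi e) -> off phi b <= off psi b.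
Proof.
  intros H.
  destruct (subst_exists phi (fun i => tvar (n + i)%nat)) as [phi' Hphi'].
  destruct (subst_exists psi (fun i => tvar (n + i)%nat)) as [psi' Hpsi'].
  pose proof (transfer T M0 M (fadd phi' (fscal (-1) (pi phi))) (fadd psi' (fscal (-1) (pi psi)))
    HT (proj1 HM0) HM) as Ht. simpl in Ht. unfold off, on.
  assert (Hs : forall e : nat -> M0, fval M0 phi' e + -1 * fval M0 (pi phi) e <=
    fval M0 psi' e + -1 * fval M0 (pi psi) e).
  { intros e. rewrite Hphi', Hpsi', !Hpi. simpl.
    specialize (H (fun i => e (n + i)%nat)). pose proof (rho_nonneg e). nra. }
  specialize (Ht Hs (join b)). rewrite Hphi', Hpsi' in Ht. simpl in Ht.
  rewrite join_shift in Ht. lra.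
Qed.

Lemma on_add phi psi b : on (fadd phi psi) b = on phi b + on psi b.
Proof.
  apply (on_eq _ (fadd (pi phi) (pi psi))). intros e. simpl. rewrite !Hpi. simpl. lra.
Qed.

Lemma on_scal c phi b : on (fscal c phi) b = c * on phi b.
Proof.
  apply (on_eq _ (fscal c (pi phi))). intros e. simpl. rewrite !Hpi. simpl. lra.
Qed.

Lemma on_one b : on fone b = w.
Proof.
  rewrite (on_eq _ rho).
  - eapply fval_local; [exact Hn|]. intros i Hi. now apply join_lt.
  - intros e. rewrite Hpi. simpl. lra.
Qed.

(** [rho] is nonnegative and does not involve the variable [n + x], so it can be pulled out of the
    supremum. *)
Lemma on_sup x phi b : on (fsup x phi) b = supM (fun m => on phi (upd b x m)).
Proof.
  rewrite (on_eq _ (fsup (n + x) (pi phi))).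
  - rewrite fval_fsup. f_equal. apply functional_extensionality. intros m.
    unfold on. now rewrite join_upd.
  - intros e. rewrite Hpi, !fval_fsup.
    destruct (fval_bounded M0 phi) as [B HB].
    rewrite Rmult_comm, <- (supM_scal _ B).
    + f_equal. apply functional_extensionality. intros m. rewrite Hpi.
      rewrite (fval_local M0 rho (fun i => (i < n)%nat) (upd e (n + x) m) e).
      * rewrite Rmult_comm. f_equal. f_equal. apply functional_extensionality. intros i.
        destruct (Nat.eq_dec i x) as [->|Hx].
        -- now rewrite !upd_same.
        -- now rewrite !upd_other by lia.
      * exact Hn.
      * intros i Hi. apply upd_other. lia.
    + apply carrier_inhabited.
    + intros m. apply (Rabs_le_between _ B), HB.
    + apply rho_nonneg.
Qed.

Lemma on_subst phi psi (s : nat -> term L) b :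
  (forall (N : Lstructure L) (e : nat -> N),
     fval N psi e = fval N phi (fun i => teval N (s i) e)) ->
  on psi b = on phi (fun i => teval M (s i) b).
Proof.
  intros H.
  (* [s'] fixes the variables of the event and acts as [s] on the shifted block. *)
  set (s' := fun i => if Nat.ltb i n then tvar i
                      else tsub (fun j => tvar (n + j)%nat) (s (i - n)%nat)).
  assert (Hlt : forall i, (i < n)%nat -> s' i = tvar i)
    by (intros i Hi; unfold s'; now apply Nat.ltb_lt in Hi as ->).
  assert (Hge : forall i, s' (n + i)%nat = tsub (fun j => tvar (n + j)%nat) (s i)).
  { intros i. unfold s'. destruct (Nat.ltb_spec (n + i) n); [lia|].
    now replace (n + i - n)%nat with i by lia. }
  destruct (subst_exists (pi phi) s') as [th Hth].
  rewrite (on_eq _ th).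
  - rewrite Hth. unfold on. f_equal. apply functional_extensionality. intros i.
    destruct (Nat.lt_ge_cases i n) as [Hi|Hi].
    + rewrite Hlt by auto. simpl. now rewrite !join_lt.
    + replace i with (n + (i - n))%nat by lia. rewrite Hge, join_ge, teval_tsub. simpl.
      now rewrite join_shift.
  - intros e. rewrite Hth, !Hpi, H. f_equal.
    + f_equal. apply functional_extensionality. intros i. rewrite Hge, teval_tsub. reflexivity.
    + eapply fval_local; [exact Hn|]. intros i Hi. cbv beta in Hi. rewrite Hlt by auto. reflexivity.
Qed.

Lemma on_sum k g b : on (fsum k g) b = sumR k (fun i => on (g i) b).
Proof.
  induction k; simpl.
  - change (on (fscal 0 fone) b = 0). rewrite on_scal. lra.
  - rewrite <- IHk. apply on_add.
Qed.

(** * The metric split into its parts on and off the event *)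

Definition ond (x y : M) : R :=
  on (fdist (tvar 0) (tvar 1)) (fun i => match i with O => x | _ => y end).
Definition offd (x y : M) : R := dist M x y - ond x y.

Lemma on_dist t1 t2 b : on (fdist t1 t2) b = ond (teval M t1 b) (teval M t2 b).
Proof.
  rewrite (on_subst (fdist (tvar 0) (tvar 1)) _ (fun i => match i with O => t1 | _ => t2 end))
    by reflexivity.
  unfold ond. f_equal. apply functional_extensionality. now intros [|i].
Qed.

Lemma off_dist t1 t2 b : off (fdist t1 t2) b = offd (teval M t1 b) (teval M t2 b).
Proof. unfold off, offd. now rewrite on_dist. Qed.

Lemma on_atom r ts b : on (fatom r ts) b = on (fatom r tvar) (fun i => teval M (ts i) b).
Proof. now apply on_subst. Qed.

Definition env3 (x y z : M) : nat -> M :=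
  fun i => match i with O => x | S O => y | _ => z end.

Lemma ond_nonneg x y : 0 <= ond x y.
Proof.
  pose proof (on_mono (fscal 0 fone) (fdist (tvar 0) (tvar 1)) (env3 x y y)) as H.
  rewrite on_scal, on_dist in H. simpl in H. rewrite <- (Rmult_0_l (on fone (env3 x y y))).
  apply H. intros e. pose proof (dist_nonneg M0 (e 0%nat) (e 1%nat)). lra.
Qed.

Lemma ond_le x y : ond x y <= w.
Proof.
  rewrite <- (on_one (env3 x y y)).
  change (ond x y) with (ond (teval M (tvar 0) (env3 x y y)) (teval M (tvar 1) (env3 x y y))).
  rewrite <- on_dist. apply on_mono. intros e. apply dist_le1.
Qed.

Lemma ond_refl x : ond x x = 0.
Proof.
  apply Rle_antisym; [|apply ond_nonneg].
  pose proof (on_mono (fdist (tvar 0) (tvar 0)) (fscal 0 fone) (env3 x x x)) as H.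
  rewrite on_scal, on_dist in H. simpl in H. rewrite !Rmult_0_l in H. apply H.
  intros e. rewrite dist_refl. lra.
Qed.

Lemma ond_sym x y : ond x y = ond y x.
Proof.
  assert (H : forall x y, ond x y <= ond y x).
  { clear x y. intros x y.
    pose proof (on_mono (fdist (tvar 0) (tvar 1)) (fdist (tvar 1) (tvar 0)) (env3 x y y)) as H.
    rewrite !on_dist in H. apply H. intros e. simpl. rewrite dist_sym. lra. }
  apply Rle_antisym; apply H.
Qed.

Lemma ond_tri x y z : ond x z <= ond x y + ond y z.
Proof.
  pose proof (on_mono (fdist (tvar 0) (tvar 2))
    (fadd (fdist (tvar 0) (tvar 1)) (fdist (tvar 1) (tvar 2))) (env3 x y z)) as H.
  rewrite on_add, !on_dist in H. apply H. intros e. apply dist_tri.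
Qed.

Lemma offd_nonneg x y : 0 <= offd x y.
Proof.
  pose proof (off_mono (fscal 0 fone) (fdist (tvar 0) (tvar 1)) (env3 x y y)) as H.
  rewrite off_dist in H. unfold off in H. rewrite on_scal in H. simpl in H.
  rewrite !Rmult_0_l, Rminus_0_r in H.
  apply H. intros e. pose proof (dist_nonneg M0 (e 0%nat) (e 1%nat)). lra.
Qed.

Lemma offd_sym x y : offd x y = offd y x.
Proof. unfold offd. now rewrite dist_sym, ond_sym. Qed.

Lemma offd_tri x y z : offd x z <= offd x y + offd y z.
Proof.
  pose proof (off_mono (fdist (tvar 0) (tvar 2))
    (fadd (fdist (tvar 0) (tvar 1)) (fdist (tvar 1) (tvar 2))) (env3 x y z)) as H.
  rewrite off_dist in H. unfold off in H. rewrite on_add, !on_dist in H. simpl in H.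
  unfold offd in *. assert (Ht := fun e : nat -> M0 => dist_tri L M0 (e 0%nat) (e 1%nat) (e 2%nat)).
  specialize (H Ht). lra.
Qed.

Lemma offd_le_dist x y : offd x y <= dist M x y.
Proof. pose proof (ond_nonneg x y). unfold offd. lra. Qed.

(** In [M0] the Lipschitz condition is an inequality between affine formulas in [2k] variables,
    which [on_mono] carries over. *)
Lemma on_fun_lip f (c d : nat -> M) :
  ond (Fint M f c) (Fint M f d) <=
  flip L f * sumR (farity L f) (fun i => ond (c i) (d i)).
Proof.
  set (k := farity L f). set (e := blk k k d c).
  assert (Hc : forall i, (i < k)%nat -> e i = c i) by (intros; apply blk_out; lia).
  assert (Hd : forall i, (i < k)%nat -> e (k + i)%nat = d i) by (intros; now apply blk_in).
  pose proof (on_mono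
    (fdist (tapp f (fun i => tvar i)) (tapp f (fun i => tvar (k + i)%nat)))
    (fscal (flip L f) (fsum k (fun i => fdist (tvar i) (tvar (k + i)%nat)))) e) as H.
  rewrite on_scal, on_sum, on_dist in H. simpl in H.
  rewrite (Fint_local M f (fun i => e i) c Hc), (Fint_local M f (fun i => e (k + i)%nat) d Hd) in H.
  rewrite (sumR_ext k _ (fun i => ond (c i) (d i))) in H.
  - apply H. intros e'. rewrite fval_fsum. simpl. apply Fint_lip.
  - intros i Hi. rewrite on_dist. simpl. now rewrite Hc, Hd.
Qed.

(* Not an instance of [fval_local]: [pi phi] may have more free variables than [phi]. *)
Lemma on_local phi k (b b' : nat -> M) :
  formula_in L k phi -> (forall i, (i < k)%nat -> b i = b' i) -> on phi b = on phi b'.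
Proof.
  intros Hk Hb.
  (* Both assignments must sit in one environment to be compared by [on_mono]: [b] goes to the even
     variables, [b'] to the odd ones. [s1] reads [b], and [s2] reads [b'], except that below [k],
     where the two agree, it takes the even variables. *)
  set (e := fun i => if Nat.even i then b (Nat.div2 i) else b' (Nat.div2 i)).
  assert (He0 : forall i, e (2 * i)%nat = b i).
  { intros i. unfold e. rewrite Nat.even_mul, Nat.div2_double. reflexivity. }
  assert (He1 : forall i, e (S (2 * i)) = b' i).
  { intros i. unfold e. rewrite Nat.even_succ, Nat.odd_mul, Nat.div2_succ_double. reflexivity. }
  set (s1 := fun i => tvar (L := L) (2 * i)%nat).
  set (s2 := fun i => tvar (L := L) (if Nat.ltb i k then 2 * i else S (2 * i))%nat).
  destruct (subst_exists phi s1) as [phi1 H1], (subst_exists phi s2) as [phi2 H2].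
  replace b with (fun i => teval M (s1 i) e)
    by (apply functional_extensionality; intros i; apply He0).
  replace b' with (fun i => teval M (s2 i) e).
  2: { apply functional_extensionality; intros i. unfold s2. simpl teval.
       destruct (Nat.ltb_spec i k); [|apply He1]. transitivity (b i); [apply He0|auto]. }
  rewrite <- (on_subst phi phi1 s1 e H1), <- (on_subst phi phi2 s2 e H2).
  assert (H : forall e : nat -> M0, fval M0 phi1 e = fval M0 phi2 e).
  { intros e'. rewrite H1, H2. eapply fval_local; [exact Hk|]. intros i Hi.
    unfold s1, s2. cbv beta in Hi. now apply Nat.ltb_lt in Hi as ->. }
  apply Rle_antisym; apply on_mono; intros e'; rewrite H; lra.
Qed.

Lemma on_rel_lip r (c d : nat -> M) :
  Rabs (on (fatom r tvar) c - on (fatom r tvar) d) <=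
  rlip L r * sumR (rarity L r) (fun i => ond (c i) (d i)).
Proof.
  set (k := rarity L r).
  assert (H : forall c d : nat -> M, on (fatom r tvar) c - on (fatom r tvar) d <=
    rlip L r * sumR k (fun i => ond (c i) (d i))).
  { clear c d. intros c d. set (e := blk k k d c).
    assert (Hc : forall i, (i < k)%nat -> e i = c i) by (intros; apply blk_out; lia).
    assert (Hd : forall i, (i < k)%nat -> e (k + i)%nat = d i) by (intros; now apply blk_in).
    assert (Hk : formula_in L k (fatom r tvar)) by (intros i Hi; exact Hi).
    pose proof (on_mono (fatom r tvar)
      (fadd (fatom r (fun i => tvar (k + i)%nat))
         (fscal (rlip L r) (fsum k (fun i => fdist (tvar i) (tvar (k + i)%nat))))) e) as H.
    rewrite on_add, on_scal, on_sum, (on_atom r (fun i => tvar (k + i)%nat)) in H.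
    simpl in H.
    rewrite (on_local _ k e c Hk Hc), (on_local _ k (fun i => e (k + i)%nat) d Hk Hd) in H.
    rewrite (sumR_ext k _ (fun i => ond (c i) (d i))) in H.
    - apply Rle_minus_l. rewrite Rplus_comm. apply H. intros e'. rewrite fval_fsum. simpl.
      pose proof (Rint_lip L M0 r e' (fun i => e' (k + i)%nat)) as Hl.
      pose proof (Rle_abs (Rint M0 r e' - Rint M0 r (fun i => e' (k + i)%nat))).
      fold k in Hl. change (fun i => e' i) with e'. lra.
    - intros i Hi. rewrite on_dist. simpl. now rewrite Hc, Hd. }
  apply Rabs_le. pose proof (H c d). pose proof (H d c) as H'.
  rewrite (sumR_ext k _ (fun i => ond (c i) (d i))) in H' by (intros; apply ond_sym). lra.
Qed.

Lemma on_rel_range r c : 0 <= on (fatom r tvar) c <= w.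
Proof.
  split.
  - rewrite <- (Rmult_0_l (on fone c)), <- on_scal. apply on_mono. intros e. simpl.
    pose proof (Rint_range L M0 r (fun i => e i)). lra.
  - rewrite <- (on_one c). apply on_mono. intros e. apply Rint_range.
Qed.

(** In [M0] the infimum over [z] is 0, attained at [u] if [rho] is 1 and at [v] if [rho] is 0. Only
    the value of the infimum passes to [M], hence the [eps]. *)
Lemma glue_approx (u v : M) (eps : R) : 0 < eps -> exists z, ond z u + offd z v < eps.
Proof.
  intros Heps. apply NNPP. intros Hno.
  set (G := fscal (-1) (fadd (pi (fdist (tvar 0) (tvar 1)))
    (fadd (fdist (tvar n) (tvar (n + 2)%nat)) (fscal (-1) (pi (fdist (tvar 0) (tvar 2))))))).
  (* The first entry of [env3 u u v] is a placeholder for the bound variable [n]. *)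
  assert (H : fval M (fscal 0 fone) (join (env3 u u v)) <= fval M (fsup n G) (join (env3 u u v))).
  { apply (transfer T M0 M _ _ HT (proj1 HM0) HM). intros e.
    assert (HG : forall z, fval M0 G (upd e n z) = 
      - (dist M0 z (e (n + 1)%nat) * fval M0 rho e + (dist M0 z (e (n + 2)%nat) -
         dist M0 z (e (n + 2)%nat) * fval M0 rho e))).
    { intros z. simpl. rewrite !Hpi. simpl. rewrite Nat.add_0_r, upd_same.
      rewrite !upd_other by lia.
      rewrite (fval_local M0 rho (fun i => (i < n)%nat) (upd e n z) e Hn); [lra|].
      intros i Hi. apply upd_other. lia. }
    destruct (H01 e) as [He|He].
    - eapply Rle_trans; [|apply (fsup_ge M0 n G e (e (n + 2)%nat))].
      rewrite HG, He, dist_refl. simpl. lra.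
    - eapply Rle_trans; [|apply (fsup_ge M0 n G e (e (n + 1)%nat))].
      rewrite HG, He, dist_refl. simpl. lra. }
  assert (H' : fval M (fsup n G) (join (env3 u u v)) <= - eps).
  { apply fsup_le. intros z. replace (upd (join (env3 u u v)) n z) with (join (env3 z u v)).
    2: { pose proof (join_upd (env3 u u v) 0 z) as Hu. rewrite Nat.add_0_r in Hu.
         rewrite Hu. f_equal.
         apply functional_extensionality. now intros [|[|i]]. }
    change (-1 * (on (fdist (tvar 0) (tvar 1)) (env3 z u v) +
      (dist M (join (env3 z u v) n) (join (env3 z u v) (n + 2)%nat) +
       -1 * on (fdist (tvar 0) (tvar 2)) (env3 z u v))) <= - eps).
    pose proof (join_ge (env3 z u v) 0) as Hz0. rewrite Nat.add_0_r in Hz0.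
    rewrite !on_dist, Hz0, join_ge. simpl.
    assert (~ ond z u + offd z v < eps) by (intros Hz; apply Hno; eauto).
    unfold offd in H0. lra. }
  change (fval M (fscal 0 fone) (join (env3 u u v))) with (0 * 1) in H. lra.
Qed.

Lemma inv_S_small (eps : R) : 0 < eps -> exists N, forall k, (N <= k)%nat -> / INR (S k) < eps.
Proof.
  intros Heps. destruct (archimed_cor1 eps Heps) as [N [HN HN0]].
  exists N. intros k Hk. eapply Rle_lt_trans; [|exact HN].
  apply Rinv_le_contravar; [now apply lt_0_INR|]. apply le_INR. lia.
Qed.

Lemma small_zero (x : R) : 0 <= x -> (forall eps, 0 < eps -> x <= eps) -> x = 0.
Proof.
  intros H0 H. apply Rle_antisym; auto. apply Rle_plus_epsilon. intros eps Heps.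
  rewrite Rplus_0_l. now apply H.
Qed.

(** The distance is [ond + offd], so approximate solutions form a Cauchy sequence, and its limit is
    an exact one. *)
Lemma glue (u v : M) : exists z, ond z u = 0 /\ offd z v = 0.
Proof.
  destruct (choice (fun k z => ond z u + offd z v < / INR (S k))) as [z Hz].
  { intros k. apply glue_approx, Rinv_0_lt_compat, lt_0_INR. lia. }
  destruct (complete L M z) as [x Hx].
  { intros eps Heps. destruct (inv_S_small (eps / 2)) as [N HN]; [lra|].
    exists N. intros i j Hi Hj.
    pose proof (Hz i). pose proof (Hz j). pose proof (HN i Hi). pose proof (HN j Hj).
    pose proof (ond_tri (z i) u (z j)). pose proof (offd_tri (z i) v (z j)).
    rewrite (ond_sym u (z j)), (offd_sym v (z j)) in *. unfold offd in *. lra. }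
  assert (H : forall eps, 0 < eps -> ond x u + offd x v <= eps).
  { intros eps Heps. destruct (inv_S_small (eps / 3)) as [N HN]; [lra|].
    destruct (Hx (eps / 3)) as [N' HN']; [lra|].
    set (k := Nat.max N N'). specialize (HN k ltac:(lia)). specialize (HN' k ltac:(lia)).
    pose proof (Hz k). pose proof (ond_tri x (z k) u). pose proof (offd_tri x (z k) v).
    rewrite (ond_sym x (z k)), (offd_sym x (z k)) in *. unfold offd in *.
    pose proof (ond_nonneg (z k) x). lra. }
  pose proof (ond_nonneg x u). pose proof (offd_nonneg x v).
  assert (ond x u + offd x v = 0) by (apply small_zero; auto; lra).
  exists x. lra.
Qed.

(** * The structure conditioned on the event *)

Context (v : M).

Definition cond_carrier : Type := {z : M | offd z v = 0}.
Definition cval (z : cond_carrier) : M := proj1_sig z.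

Lemma glue_sig (u : M) : {z : cond_carrier | ond (cval z) u = 0}.
Proof.
  destruct (constructive_indefinite_description _ (glue u v)) as [z [H1 H2]].
  now exists (exist _ z H2).
Qed.

Definition restr (u : M) : cond_carrier := proj1_sig (glue_sig u).

Lemma ond_restr u : ond (cval (restr u)) u = 0.
Proof. exact (proj2_sig (glue_sig u)). Qed.

(** Both points agree with [v] off the event, so their whole distance lives on it. *)
Lemma dist_cval (x y : cond_carrier) : dist M (cval x) (cval y) = ond (cval x) (cval y).
Proof.
  destruct x as [x Hx], y as [y Hy]. simpl.
  pose proof (offd_tri x v y). pose proof (offd_nonneg x y). rewrite (offd_sym v y) in H.
  unfold offd in *. lra.
Qed.

Lemma cval_inj (x y : cond_carrier) : cval x = cval y -> x = y.
Proof.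
  destruct x as [x Hx], y as [y Hy]. simpl. intros ->. f_equal. apply proof_irrelevance.
Qed.

Lemma div_le (x y : R) : x <= y -> x / w <= y / w.
Proof.
  intros H. apply Rmult_le_compat_r; auto. left. now apply Rinv_0_lt_compat.
Qed.

(** Division by [w], the weight of the whole event, is what makes [fone] evaluate to 1. It scales
    both sides of a Lipschitz inequality alike, so the constants of the language survive. *)
Definition cdist (x y : cond_carrier) : R := ond (cval x) (cval y) / w.

Lemma cdist_refl x : cdist x x = 0.
Proof. unfold cdist. rewrite ond_refl. unfold Rdiv. lra. Qed.

Lemma cdist_sep x y : cdist x y = 0 -> x = y.
Proof.
  unfold cdist. intros H. apply cval_inj, dist_sep. rewrite dist_cval.
  apply (Rmult_eq_reg_r (/ w)); [unfold Rdiv in H; lra|].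
  apply Rinv_neq_0_compat. unfold w. lra.
Qed.

Lemma cdist_sym x y : cdist x y = cdist y x.
Proof. unfold cdist. now rewrite ond_sym. Qed.

Lemma cdist_tri x y z : cdist x z <= cdist x y + cdist y z.
Proof. unfold cdist. rewrite <- Rdiv_plus_distr. apply div_le, ond_tri. Qed.

Lemma cdist_le1 x y : cdist x y <= 1.
Proof.
  unfold cdist. replace 1 with (w / w) by (field; unfold w; lra). apply div_le, ond_le.
Qed.

Lemma cdist_lt_iff x y eps : cdist x y < eps <-> dist M (cval x) (cval y) < eps * w.
Proof. rewrite dist_cval. unfold cdist. apply Rlt_div_l. exact Hw. Qed.

Lemma cdist_complete (u : nat -> cond_carrier) :
  (forall eps, 0 < eps -> exists N, forall m n, (N <= m)%nat -> (N <= n)%nat ->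
     cdist (u m) (u n) < eps) ->
  exists x, forall eps, 0 < eps -> exists N, forall n, (N <= n)%nat -> cdist (u n) x < eps.
Proof.
  intros Hu. destruct (complete L M (fun k => cval (u k))) as [x Hx].
  { intros eps Heps. destruct (Hu (eps / w)) as [N HN]; [now apply Rdiv_lt_0_compat|].
    exists N. intros i j Hi Hj. specialize (HN i j Hi Hj). apply cdist_lt_iff in HN.
    replace eps with (eps / w * w) by (field; unfold w; lra). exact HN. }
  assert (Hxv : offd x v = 0).
  { apply small_zero; [apply offd_nonneg|]. intros eps Heps.
    destruct (Hx eps Heps) as [N HN]. specialize (HN N (Nat.le_refl N)).
    pose proof (offd_tri x (cval (u N)) v) as H.
    assert (Hv : offd (cval (u N)) v = 0) by apply (proj2_sig (u N)). rewrite Hv in H.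
    pose proof (offd_le_dist x (cval (u N))). rewrite dist_sym in H0. lra. }
  exists (exist _ x Hxv). intros eps Heps.
  destruct (Hx (eps * w)) as [N HN]; [now apply Rmult_lt_0_compat|].
  exists N. intros k Hk. apply cdist_lt_iff. now apply HN.
Qed.

Lemma ond_restr_both x y : ond (cval (restr x)) (cval (restr y)) = ond x y.
Proof.
  pose proof (ond_restr x). pose proof (ond_restr y).
  pose proof (ond_tri (cval (restr x)) x (cval (restr y))).
  pose proof (ond_tri x y (cval (restr y))).
  pose proof (ond_tri x (cval (restr x)) y).
  pose proof (ond_tri (cval (restr x)) (cval (restr y)) y).
  rewrite (ond_sym y) in *. rewrite (ond_sym x (cval (restr x))) in *. lra.
Qed.

(** The carrier need not be closed under [Fint M f], as [f(v, ..., v)] may differ from [v] off the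
    event; hence [restr]. *)
Definition cond_structure : Lstructure L.
Proof.
  refine {|
    carrier := cond_carrier;
    carrier_inhabited := inhabits (restr v);
    dist := cdist;
    dist_refl := cdist_refl;
    dist_sep := cdist_sep;
    dist_sym := cdist_sym;
    dist_tri := cdist_tri;
    dist_le1 := cdist_le1;
    complete := cdist_complete;
    Fint := fun f c => restr (Fint M f (fun i => cval (c i)));
    Rint := fun r c => on (fatom r tvar) (fun i => cval (c i)) / w
  |}.
  - intros f c d. unfold cdist. rewrite ond_restr_both.
    replace (flip L f * _) with
      ((flip L f * sumR (farity L f) (fun i => ond (cval (c i)) (cval (d i)))) / w).
    + apply div_le, on_fun_lip.
    + unfold Rdiv. rewrite (Rmult_assoc (flip L f)). f_equal.
      rewrite Rmult_comm, <- sumR_scal. apply sumR_ext. intros i _. apply Rmult_comm.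
  - intros r c d. unfold Rdiv. rewrite <- Rmult_minus_distr_r.
    rewrite Rabs_mult, (Rabs_pos_eq (/ w)) by (left; now apply Rinv_0_lt_compat).
    replace (rlip L r * _) with
      ((rlip L r * sumR (rarity L r) (fun i => ond (cval (c i)) (cval (d i)))) / w).
    + apply div_le, on_rel_lip.
    + unfold cdist, Rdiv. rewrite (Rmult_assoc (rlip L r)). f_equal.
      rewrite Rmult_comm, <- sumR_scal. apply sumR_ext. intros i _. apply Rmult_comm.
  - intros r c. pose proof (on_rel_range r (fun i => cval (c i))) as [H1 H2]. split.
    + replace 0 with (0 / w) by (unfold Rdiv; lra). now apply div_le.
    + replace 1 with (w / w) by (field; unfold w; lra). now apply div_le.
Defined.

Lemma ond_teval t (b c : nat -> M) :
  (forall i, ond (b i) (c i) = 0) -> ond (teval M t b) (teval M t c) = 0.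
Proof.
  intros H. induction t as [i|f ts IH]; simpl; auto.
  apply Rle_antisym; [|apply ond_nonneg].
  eapply Rle_trans; [apply on_fun_lip|]. rewrite sumR_zero; [lra|auto].
Qed.

Lemma ond_congr x x' y y' : ond x x' = 0 -> ond y y' = 0 -> ond x y = ond x' y'.
Proof.
  intros H1 H2.
  pose proof (ond_tri x x' y). pose proof (ond_tri x' y' y).
  pose proof (ond_tri x' x y'). pose proof (ond_tri x y y').
  rewrite (ond_sym x' x), (ond_sym y' y) in *. lra.
Qed.

Lemma on_finf x phi b : on (finf x phi) b = - on (fsup x (fscal (-1) phi)) b.
Proof.
  replace (- on (fsup x (fscal (-1) phi)) b)
    with (on (fscal (-1) (fsup x (fscal (-1) phi))) b) by (rewrite on_scal; lra).
  assert (H : forall e : nat -> M0, fval M0 (finf x phi) e =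
    fval M0 (fscal (-1) (fsup x (fscal (-1) phi))) e).
  { intros e. rewrite finf_opp.
    change (fval M0 (fscal (-1) (fsup x (fscal (-1) phi))) e)
      with (-1 * fval M0 (fsup x (fscal (-1) phi)) e). lra. }
  apply Rle_antisym; apply on_mono; intros e; rewrite H; lra.
Qed.

Lemma on_congr phi : forall b c : nat -> M,
  (forall i, ond (b i) (c i) = 0) -> on phi b = on phi c.
Proof.
  assert (Hupd : forall (b c : nat -> M) x m, (forall i, ond (b i) (c i) = 0) ->
    forall i, ond (upd b x m i) (upd c x m i) = 0).
  { intros b c x m H i. destruct (Nat.eq_dec i x) as [->|Hx].
    - rewrite !upd_same. apply ond_refl.
    - now rewrite !upd_other. }
  induction phi as [ |r ts|t1 t2|k p IH|p IHp q IHq|x p IH|x p IH]; intros b c H.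
  - now rewrite !on_one.
  - rewrite !(on_atom r ts).
    pose proof (on_rel_lip r (fun i => teval M (ts i) b) (fun i => teval M (ts i) c)) as Hl.
    rewrite sumR_zero in Hl by (intros; now apply ond_teval).
    rewrite Rmult_0_r in Hl. apply Rminus_diag_uniq, Rabs_eq_0, Rle_antisym; auto.
    apply Rabs_pos.
  - rewrite !on_dist. apply ond_congr; now apply ond_teval.
  - rewrite !on_scal. f_equal. now apply IH.
  - rewrite !on_add. f_equal; auto.
  - rewrite !on_finf, !on_sup. do 2 f_equal. apply functional_extensionality. intros m.
    rewrite !on_scal. f_equal. apply IH. auto.
  - rewrite !on_sup. f_equal. apply functional_extensionality. intros m. apply IH. auto.
Qed.

Lemma ond_teval_cond t (b : nat -> cond_structure) :
  ond (cval (teval cond_structure t b)) (teval M t (fun i => cval (b i))) = 0.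
Proof.
  induction t as [i|f ts IH]; simpl.
  - apply ond_refl.
  - apply Rle_antisym; [|apply ond_nonneg].
    eapply Rle_trans; [apply (ond_tri _ (Fint M f (fun i => cval (teval cond_structure (ts i) b))))|].
    rewrite ond_restr, Rplus_0_l.
    eapply Rle_trans; [apply on_fun_lip|]. rewrite sumR_zero; [lra|auto].
Qed.

(** The supremum over representatives is the one over all of [M]: [on] cannot tell [m] from
    [restr m]. *)
Lemma fval_cond_sup x p :
  (forall b : nat -> cond_structure,
     fval cond_structure p b = on p (fun i => cval (b i)) / w) ->
  forall b : nat -> cond_structure,
     fval cond_structure (fsup x p) b = on (fsup x p) (fun i => cval (b i)) / w.
Proof.
  intros IH b. rewrite fval_fsup, on_sup. unfold Rdiv. rewrite Rmult_comm.
  assert (Hc : forall m : cond_structure,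
    (fun i => cval (upd b x m i)) = upd (fun i => cval (b i)) x (cval m)).
  { intros m. apply functional_extensionality. intros i. unfold upd. now destruct (Nat.eqb i x). }
  destruct (fval_bounded M (pi p)) as [B HB].
  rewrite <- (supM_scal _ B).
  - apply supM_eq.
    + intros m. exists (cval m). rewrite IH, Hc. apply Rmult_comm.
    + intros m. exists (restr m). rewrite IH, Hc. unfold Rdiv. rewrite Rmult_comm. f_equal.
      apply on_congr. intros i. destruct (Nat.eq_dec i x) as [->|Hx].
      * rewrite !upd_same. apply ond_restr.
      * rewrite !upd_other by auto. apply ond_refl.
  - apply carrier_inhabited.
  - intros m. apply (Rabs_le_between _ B), HB.
  - left. now apply Rinv_0_lt_compat.
Qed.

(** The counterpart of the theorem of Los: a value in the conditioned structure is the average over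
    the event. *)
Lemma fval_cond phi : forall b : nat -> cond_structure,
  fval cond_structure phi b = on phi (fun i => cval (b i)) / w.
Proof.
  induction phi as [ |r ts|t1 t2|k p IH|p IHp q IHq|x p IH|x p IH]; intros b.
  - rewrite on_one. simpl. field. unfold w. lra.
  - rewrite on_atom. simpl. f_equal. apply on_congr. intros i. apply ond_teval_cond.
  - rewrite on_dist. simpl. unfold cdist. f_equal. apply ond_congr; apply ond_teval_cond.
  - rewrite on_scal. simpl. rewrite IH. unfold Rdiv. lra.
  - rewrite on_add. simpl. rewrite IHp, IHq. unfold Rdiv. lra.
  - rewrite finf_opp, on_finf, fval_cond_sup.
    + unfold Rdiv. lra.
    + intros b'. rewrite on_scal. simpl. rewrite IH. unfold Rdiv. lra.
  - now apply fval_cond_sup.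
Qed.

Lemma in_S_cond k b : in_S T k (fun phi => on phi b / w).
Proof.
  exists cond_structure, (fun i => restr (b i)). split.
  - intros phi psi Hc e. rewrite !fval_cond. apply div_le, on_mono. intros e'.
    now apply (proj1 HM0).
  - intros phi _. unfold tp. rewrite fval_cond. f_equal. symmetry. apply on_congr.
    intros i. apply ond_restr.
Qed.
End Conditioning.

(** * Extremal models are first order *)

Lemma event_weights (rho : formula L) n :
  (forall M, first_order_model M -> forall e, fval M rho e = 0 \/ fval M rho e = 1) ->
  exists pi : formula L -> formula L, forall phi (e : nat -> M0),
    fval M0 (pi phi) e = fval M0 phi (fun i => e (n + i)%nat) * fval M0 rho e.
Proof.
  intros H01.
  apply (choice (fun phi psi => forall e : nat -> M0,
    fval M0 psi e = fval M0 phi (fun i => e (n + i)%nat) * fval M0 rho e)).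
  intros phi. destruct (subst_exists phi (fun i => tvar (n + i)%nat)) as [phi' Hphi'].
  destruct (affine_def_mult phi' rho H01) as [psi Hpsi]. exists psi. intros e.
  rewrite Hpsi, Hphi' by auto. reflexivity.
Qed.

Lemma extremal_event (M : Lstructure L) n (a : nat -> M) rho :
  Models M T -> extremal T M -> formula_in L n rho ->
  (forall M, first_order_model M -> forall e, fval M rho e = 0 \/ fval M rho e = 1) ->
  fval M rho a = 0 \/ fval M rho a = 1.
Proof.
  intros HM Hext Hn H01.
  set (rho' := fadd fone (fscal (-1) rho)).
  assert (Hn' : formula_in L n rho') by (split; [exact I|exact Hn]).
  assert (H01' : forall M, first_order_model M -> forall e,
    fval M rho' e = 0 \/ fval M rho' e = 1).
  { intros M' HM' e. simpl. destruct (H01 M' HM' e); lra. }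
  assert (Hb : 0 <= fval M rho a <= 1).
  { split.
    - replace 0 with (fval M (fscal 0 fone) a) by (simpl; lra).
      apply (transfer T M0 M _ _ HT (proj1 HM0) HM). intros e. simpl.
      destruct (H01 M0 (proj2 HM0) e); lra.
    - change 1 with (fval M fone a).
      apply (transfer T M0 M _ _ HT (proj1 HM0) HM). intros e. simpl.
      destruct (H01 M0 (proj2 HM0) e); lra. }
  apply NNPP. intros Hno.
  destruct (event_weights rho n H01) as [pi Hpi].
  destruct (event_weights rho' n H01') as [pi' Hpi'].
  assert (Hw : 0 < fval M rho a) by lra.
  assert (Hw' : 0 < fval M rho' a) by (simpl; lra).
  set (J := join M n a a).
  set (w := fval M rho a) in *.
  destruct (Hext n a) as [_ H].
  assert (Hww : fval M rho' a = 1 - w) by (simpl; fold w; lra).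
  pose proof (in_S_cond M HM n a rho Hn (H01 M0 (proj2 HM0)) Hw pi Hpi (a 0%nat) n a) as Sq.
  pose proof (in_S_cond M HM n a rho' Hn' (H01' M0 (proj2 HM0)) Hw' pi' Hpi' (a 0%nat) n a) as Sr.
  fold w in Sq. rewrite Hww in Sr. unfold on in Sq, Sr. fold J in Sq, Sr.
  assert (Heq : forall phi psi, (forall e : nat -> M0, fval M0 phi e = fval M0 psi e) ->
    forall e : nat -> M, fval M phi e = fval M psi e).
  { intros phi psi He e.
    apply Rle_antisym; apply (transfer T M0 M _ _ HT (proj1 HM0) HM); intros e'; rewrite He; lra. }
  specialize (H _ _ w Sq Sr ltac:(lra)). cbv beta in H.
  assert (Hmix : forall phi, fval M (pi phi) J + fval M (pi' phi) J = fval M phi a).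
  { intros phi. destruct (subst_exists phi (fun i => tvar (n + i)%nat)) as [phi' Hphi'].
    pose proof (Heq (fadd (pi phi) (pi' phi)) phi') as E. simpl in E. rewrite E.
    - rewrite Hphi'. simpl. unfold J. now rewrite join_shift.
    - intros e. rewrite Hpi, Hpi', Hphi'. simpl. lra. }
  (* Extremality makes the two conditioned types equal; evaluated at [rho] itself they are 1 and 0,
     the contradiction sought. *)
  assert (E : fval M (pi rho) J / w = fval M (pi' rho) J / (1 - w)).
  { apply H; auto. intros phi _. unfold tp. rewrite <- (Hmix phi). field. lra. }
  (* The two factors in [pi rho] read separate blocks of variables. [s] identifies the blocks, as
     [J] does by using [a] twice, and then [rho rho = rho] and [rho (1 - rho) = 0] are available in
     [M0]. *)
  set (s := fun i => tvar (L := L) (if Nat.ltb i n then i else i - n)%nat).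
  assert (HJ : J = fun i => teval M (s i) a).
  { apply functional_extensionality. intros i. unfold J, join, s. simpl.
    now destruct (Nat.ltb i n). }
  assert (Hs : forall e : nat -> M0, (fun i => teval M0 (s (n + i)%nat) e) = e).
  { intros e. apply functional_extensionality. intros i. unfold s.
    destruct (Nat.ltb_spec (n + i) n); [lia|]. simpl. f_equal. lia. }
  assert (Hs' : forall e : nat -> M0, fval M0 rho (fun i => teval M0 (s i) e) = fval M0 rho e).
  { intros e. eapply fval_local; [exact Hn|]. intros i Hi. unfold s.
    cbv beta in Hi. now apply Nat.ltb_lt in Hi as ->. }
  destruct (subst_exists (pi rho) s) as [th Hth], (subst_exists (pi' rho) s) as [th' Hth'].
  assert (E1 : fval M (pi rho) J = w).
  { rewrite HJ, <- Hth. apply Heq. intros e. rewrite Hth, Hpi, Hs, Hs'.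
    destruct (H01 M0 (proj2 HM0) e) as [-> | ->]; lra. }
  assert (E2 : fval M (pi' rho) J = 0).
  { rewrite HJ, <- Hth'. rewrite (Heq th' (fscal 0 fone)); [simpl; lra|].
    intros e. rewrite Hth', Hpi', Hs. unfold rho'. cbn [fval]. rewrite Hs'.
    destruct (H01 M0 (proj2 HM0) e) as [-> | ->]; lra. }
  rewrite E1, E2 in E. unfold Rdiv in E. rewrite Rinv_r, Rmult_0_l in E by lra. lra.
Qed.

Lemma extremal_fo_model (M : Lstructure L) :
  Models M T -> extremal T M -> first_order_model M.
Proof.
  intros HM Hext. split.
  - intros x y.
    apply (extremal_event M 2 (fun i => match i with O => x | _ => y end)
      (fdist (tvar 0) (tvar 1))); auto.
    + split; simpl; lia.
    + intros M' [H _] e. apply H.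
  - intros r c. apply (extremal_event M (rarity L r) c (fatom r tvar)); auto.
    + intros i Hi. exact Hi.
    + intros M' [_ H] e. apply H.
Qed.
End Theory.

(** * The extremal theory *)

Section FirstOrderTheory.
Context {L : language}.

Lemma fteval_local (N : FOstructure L) (P : nat -> Prop) t (e e' : nat -> N) :
  tfv L P t -> (forall i, P i -> e i = e' i) -> fteval N t e = fteval N t e'.
Proof.
  intros Ht He. induction t as [i|f ts IH]; simpl in *; auto.
  apply FFint_local. intros i Hi. apply IH. now apply Ht.
Qed.

Lemma fsat_local (N : FOstructure L) s : forall (P : nat -> Prop) (e e' : nat -> N),
  Ffv L P s -> (forall i, P i -> e i = e' i) -> (fsat N s e <-> fsat N s e').
Proof.
  induction s as [ |t1 t2|r ts|p IH|p IHp q IHq|p IHp q IHq|p IHp q IHq|x p IH|x p IH];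
    intros P e e' Hs He; simpl in *.
  - tauto.
  - destruct Hs. now rewrite (fteval_local N P t1 e e'), (fteval_local N P t2 e e').
  - apply FRint_local. intros i Hi. eapply fteval_local; eauto.
  - now rewrite (IH P e e').
  - destruct Hs. now rewrite (IHp P e e'), (IHq P e e').
  - destruct Hs. now rewrite (IHp P e e'), (IHq P e e').
  - destruct Hs. now rewrite (IHp P e e'), (IHq P e e').
  - split; intros H m; (eapply IH; [exact Hs| |apply (H m)]);
      apply upd_agree; intros; [symmetry|]; auto.
  - split; intros [m H]; exists m; (eapply IH; [exact Hs| |apply H]);
      apply upd_agree; intros; [symmetry|]; auto.
Qed.

Fixpoint falls (m n : nat) (s : fformula L) : fformula L :=
  match n with O => s | S k => Fall L m (falls (S m) k s) end.

Lemma Ffv_falls n s : forall m (P : nat -> Prop),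
  Ffv L (fun i => (m <= i < m + n)%nat \/ P i) s -> Ffv L P (falls m n s).
Proof.
  induction n as [|n IH]; simpl; intros m P H.
  - eapply Ffv_mono; [|exact H]. intros i [Hi|Hi]; [lia|auto].
  - apply IH. eapply Ffv_mono; [|exact H]. intros i [Hi|Hi]; [|auto].
    destruct (Nat.eq_dec i m); [auto|left; lia].
Qed.

Lemma fsat_falls (N : FOstructure L) n s : forall m,
  (forall e : nat -> N, fsat N s e) <-> (forall e : nat -> N, fsat N (falls m n s) e).
Proof.
  induction n as [|n IH]; intros m; simpl; [tauto|].
  rewrite (IH (S m)). split.
  - intros H e k. apply H.
  - intros H e. specialize (H e (e m)).
    replace (upd e m (e m)) with e in H; auto.
    apply functional_extensionality. intros i. unfold upd.
    destruct (Nat.eqb_spec i m) as [->|]; auto.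
Qed.

Lemma fsat_iso (M : Lstructure L) (N : FOstructure L) (h : M -> N) (g : N -> M) :
  (forall x, g (h x) = x) -> (forall y, h (g y) = y) ->
  (forall f (a : nat -> M), h (Fint M f a) = FFint N f (fun i => h (a i))) ->
  (forall r (a : nat -> M), Rint M r a = 1 <-> FRint N r (fun i => h (a i))) ->
  forall s (e : nat -> M), fsat (fo_of M) s e <-> fsat N s (fun i => h (e i)).
Proof.
  intros Hgh Hhg HF HR.
  assert (Ht : forall t (e : nat -> M),
    h (fteval (fo_of M) t e) = fteval N t (fun i => h (e i))).
  { intros t e. induction t as [i|f ts IH]; simpl; auto. rewrite HF. f_equal.
    now apply functional_extensionality. }
  assert (Hu : forall (e : nat -> M) x m,
    (fun i => h (upd e x m i)) = upd (fun i => h (e i)) x (h m)).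
  { intros e x m. apply functional_extensionality. intros i. unfold upd.
    now destruct (Nat.eqb i x). }
  induction s as [ |t1 t2|r ts|p IH|p IHp q IHq|p IHp q IHq|p IHp q IHq|x p IH|x p IH];
    intros e; simpl.
  - tauto.
  - rewrite <- !Ht. split; [congruence|]. intros H. apply (f_equal g) in H. now rewrite !Hgh in H.
  - rewrite HR. replace (fun i => h (fteval (fo_of M) (ts i) e))
      with (fun i => fteval N (ts i) (fun i => h (e i))); [tauto|].
    apply functional_extensionality. intros i. now rewrite Ht.
  - now rewrite IH.
  - now rewrite IHp, IHq.
  - now rewrite IHp, IHq.
  - now rewrite IHp, IHq.
  - split; intros H m.
    + rewrite <- (Hhg m), <- Hu. apply IH, H.
    + apply IH. rewrite Hu. apply H.
  - split.
    + intros [m H]. exists (h m). rewrite <- Hu. now apply IH.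
    + intros [m H]. exists (g m). apply IH. now rewrite Hu, Hhg.
Qed.

Definition fo_theory (M : Lstructure L) : FOtheory L :=
  fun s => fsentence L s /\ forall e, fsat (fo_of M) s e.

(** [fo_theory] contains sentences only; open formulas are reached through universal closures. *)
Lemma fo_theory_models (M : Lstructure L) (N : FOstructure L) s :
  FModels N (fo_theory M) -> (forall e, fsat (fo_of M) s e) -> forall e, fsat N s e.
Proof.
  intros HN Hs. destruct (fformula_bound s) as [n Hn].
  apply (fsat_falls N n s 0). apply HN. split.
  - apply Ffv_falls. eapply Ffv_mono; [|exact Hn]. intros i Hi. cbv beta in Hi. left. lia.
  - now apply fsat_falls.
Qed.

Lemma fo_theory_complete (M : Lstructure L) : FO_complete (fo_theory M).
Proof.
  split; [now intros s []|]. split.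
  - exists (fo_of M). intros s [_ Hs]. exact Hs.
  - intros s Hs.
    assert (Hl : forall e e' : nat -> M, fsat (fo_of M) s e <-> fsat (fo_of M) s e').
    { intros e e'. apply (fsat_local (fo_of M) s (fun _ => False)); [exact Hs|tauto]. }
    destruct (carrier_inhabited L M) as [m].
    destruct (classic (fsat (fo_of M) s (fun _ => m))) as [H|H].
    + left. intros N HN. apply HN. split; auto. intros e. now apply (Hl (fun _ => m)).
    + right. intros N HN. change (forall e : nat -> N, fsat N (Fneg L s) e).
      apply HN. split; auto. intros e He. apply H. now apply (Hl e).
Qed.

(** * Models of the extremal theory as metric structures *)

(* The Lipschitz condition with constant [lam] for a discrete metric says: if the
   coordinates where two k-tuples differ form a set S with [lam * |S| < 1], then the
   values agree.  Each set S gives one first order formula; the two tuples are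
   the variables [i] and [k + i]. *)
Fixpoint agree_off (S : nat -> bool) (k n : nat) : fformula L :=
  match n with
  | O => Fneg L (Ffalse L)
  | Datatypes.S j => Fand L (agree_off S k j)
      (if S j then Fneg L (Ffalse L) else Feq L (tvar j) (tvar (k + j)%nat))
  end.

Lemma fsat_agree_off (N : FOstructure L) S k n (e : nat -> N) :
  fsat N (agree_off S k n) e <->
  forall i, (i < n)%nat -> S i = false -> e i = e (k + i)%nat.
Proof.
  induction n as [|n IH]; simpl.
  - split; [intros; lia|tauto].
  - rewrite IH. split.
    + intros [H1 H2] i Hi HS. destruct (Nat.eq_dec i n) as [->|Hne].
      * rewrite HS in H2. exact H2.
      * apply H1; auto. lia.
    + intros H. split; [intros; apply H; auto|].
      destruct (S n) eqn:E; simpl; auto.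
Qed.

Definition bool_ind (b : bool) : R := if b then 1 else 0.

Lemma sumR_agree (M : Lstructure L) S k n (e : nat -> M) :
  fsat (fo_of M) (agree_off S k n) e ->
  sumR n (fun i => dist M (e i) (e (k + i)%nat)) <= sumR n (fun i => bool_ind (S i)).
Proof.
  rewrite fsat_agree_off. intros H. apply sumR_le. intros i Hi. unfold bool_ind.
  destruct (S i) eqn:E; [apply dist_le1|].
  assert (He : e i = e (k + i)%nat) by (apply H; auto). rewrite <- He, dist_refl. lra.
Qed.

Definition neqb {A : Type} (x y : A) : bool :=
  if excluded_middle_informative (x = y) then false else true.

Lemma neqb_false {A : Type} (x y : A) : neqb x y = false <-> x = y.
Proof. unfold neqb. destruct (excluded_middle_informative (x = y)); intuition discriminate. Qed.

Section Discrete.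
Context (M0 : Lstructure L) (Hfo : first_order_model M0).
Context (N : FOstructure L) (HN : FModels N (fo_theory M0)).

(** If the bound failed, the set [S] of coordinates where [c] and [d] differ would be so small that
    [agree_off S] implies [s] throughout [M0], hence throughout [N]. The formula mentions only the
    pattern [S], never the elements of [N]. *)
Lemma discrete_lip (s : fformula L) (k : nat) (lam : R) (c d : nat -> N) :
  0 <= lam ->
  (forall e : nat -> M0,
     lam * sumR k (fun i => dist M0 (e i) (e (k + i)%nat)) < 1 -> fsat (fo_of M0) s e) ->
  ~ fsat N s (blk k k d c) ->
  1 <= lam * sumR k (fun i => bool_ind (neqb (c i) (d i))).
Proof.
  intros Hlam Hs Hc. apply Rnot_lt_le. intros Hlt. apply Hc.
  set (S := fun i => neqb (c i) (d i)).
  assert (H : forall e, fsat N (Fimp L (agree_off S k k) s) e).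
  { apply (fo_theory_models M0 N); auto. intros e Ha. apply Hs.
    eapply Rle_lt_trans; [|exact Hlt]. apply Rmult_le_compat_l; auto.
    now apply sumR_agree. }
  apply H. apply fsat_agree_off. intros i Hi HS. apply (neqb_false (c i) (d i)) in HS.
  rewrite blk_in by auto. rewrite blk_out by lia. exact HS.
Qed.

Definition ddist (x y : N) : R := bool_ind (neqb x y).

Lemma ddist_cases x y : (x = y /\ ddist x y = 0) \/ (x <> y /\ ddist x y = 1).
Proof.
  unfold ddist, neqb. destruct (excluded_middle_informative (x = y)); simpl; auto.
Qed.

Lemma ddist_complete (u : nat -> N) :
  (forall eps, 0 < eps -> exists n0, forall m n, (n0 <= m)%nat -> (n0 <= n)%nat ->
     ddist (u m) (u n) < eps) ->
  exists x, forall eps, 0 < eps -> exists n0, forall n, (n0 <= n)%nat -> ddist (u n) x < eps.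
Proof.
  (* Points at distance below 1 are equal, so the sequence is eventually constant. *)
  intros Hu. destruct (Hu 1 Rlt_0_1) as [n0 H]. exists (u n0). intros eps Heps.
  exists n0. intros n Hn. specialize (H n n0 Hn (Nat.le_refl n0)).
  destruct (ddist_cases (u n) (u n0)) as [[_ E]|[_ E]]; lra.
Qed.

Definition discrete_structure : Lstructure L.
Proof.
  refine {|
    carrier := N;
    carrier_inhabited := fcarrier_inhabited L N;
    dist := ddist;
    complete := ddist_complete;
    Fint := FFint N;
    Rint := fun r c => ind (FRint N r c)
  |}.
  - intros x. destruct (ddist_cases x x); tauto.
  - intros x y H. destruct (ddist_cases x y) as [|[_ E]]; [tauto|lra].
  - intros x y. destruct (ddist_cases x y) as [[H1 ->]|[H1 ->]];
    destruct (ddist_cases y x) as [[H2 ->]|[H2 ->]]; auto; congruence.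
  - intros x y z. destruct (ddist_cases x y) as [[H1 ->]|[H1 ->]];
    destruct (ddist_cases y z) as [[H2 ->]|[H2 ->]];
    destruct (ddist_cases x z) as [[H3 ->]|[H3 ->]]; try lra. congruence.
  - intros x y. destruct (ddist_cases x y) as [[_ ->]|[_ ->]]; lra.
  - intros f c d. set (k := farity L f).
    assert (Hpos : 0 <= flip L f * sumR k (fun i => ddist (c i) (d i))).
    { apply Rmult_le_pos; [apply flip_nonneg|]. apply sumR_nonneg. intros i _.
      destruct (ddist_cases (c i) (d i)) as [[_ ->]|[_ ->]]; lra. }
    destruct (ddist_cases (FFint N f c) (FFint N f d)) as [[_ ->]|[Hne ->]]; auto.
    (* In [M0] distinct values have distance 1, so a Lipschitz bound below 1 forces them to be
       equal. *)
    apply (discrete_lip (Feq L (tapp f (fun i => tvar i)) (tapp f (fun i => tvar (k + i)%nat)))).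
    + apply flip_nonneg.
    + intros e He. simpl. destruct (proj1 Hfo (Fint M0 f e) (Fint M0 f (fun i => e (k + i)%nat)))
        as [H0|H1]; [now apply dist_sep|].
      pose proof (Fint_lip L M0 f e (fun i => e (k + i)%nat)). fold k in H. lra.
    + simpl. intros Heq. apply Hne.
      rewrite (FFint_local L N f c (blk k k d c)) by (intros; rewrite blk_out by (unfold k in *; lia); auto).
      rewrite (FFint_local L N f d (fun i => blk k k d c (k + i)%nat))
        by (intros; rewrite blk_in by auto; auto).
      exact Heq.
  - intros r. set (k := rarity L r).
    assert (Hone : forall c d : nat -> N, FRint N r c -> ~ FRint N r d ->
      1 <= rlip L r * sumR k (fun i => ddist (c i) (d i))).
    { intros c d Hc Hd.
      apply (discrete_lip (Fimp L (Frel L r (fun i => tvar i)) (Frel L r (fun i => tvar (k + i)%nat)))).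
      - apply rlip_nonneg.
      - intros e He H1. simpl in *.
        destruct (proj2 Hfo r (fun i => e (k + i)%nat)) as [H0|H0]; auto.
        pose proof (Rint_lip L M0 r e (fun i => e (k + i)%nat)). fold k in H.
        pose proof (Rle_abs (Rint M0 r e - Rint M0 r (fun i => e (k + i)%nat))).
        change (Rint M0 r e = 1) in H1. lra.
      - simpl. intros Himp. apply Hd.
        apply (FRint_local L N r d (fun i => blk k k d c (k + i)%nat));
          [intros; rewrite blk_in by auto; auto|].
        apply Himp. apply (FRint_local L N r c (blk k k d c)); auto.
        intros; rewrite blk_out by (unfold k in *; lia); auto. }
    intros c d.
    destruct (ind_cases (FRint N r c)) as [[H1 ->]|[H1 ->]];
    destruct (ind_cases (FRint N r d)) as [[H2 ->]|[H2 ->]].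
    + rewrite Rminus_diag, Rabs_R0. apply Rmult_le_pos; [apply rlip_nonneg|].
      apply sumR_nonneg. intros i _. destruct (ddist_cases (c i) (d i)) as [[_ ->]|[_ ->]]; lra.
    + rewrite Rminus_0_r, Rabs_R1. now apply Hone.
    + rewrite Rminus_0_l, Rabs_Ropp, Rabs_R1.
      rewrite (sumR_ext _ _ (fun i => ddist (d i) (c i))); [now apply Hone|].
      intros i _. destruct (ddist_cases (c i) (d i)) as [[E1 ->]|[E1 ->]];
      destruct (ddist_cases (d i) (c i)) as [[E2 ->]|[E2 ->]]; auto; congruence.
    + rewrite Rminus_diag, Rabs_R0. apply Rmult_le_pos; [apply rlip_nonneg|].
      apply sumR_nonneg. intros i _. destruct (ddist_cases (c i) (d i)) as [[_ ->]|[_ ->]]; lra.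
  - intros r c. apply ind_bounds.
Defined.

Lemma discrete_rel_one r (c : nat -> N) : ind (FRint N r c) = 1 <-> FRint N r c.
Proof. destruct (ind_cases (FRint N r c)) as [[H ->]|[H ->]]; split; auto; lra || tauto. Qed.

Lemma discrete_first_order : first_order_model discrete_structure.
Proof.
  split.
  - intros x y. simpl. destruct (ddist_cases x y); tauto.
  - intros r c. simpl. destruct (ind_cases (FRint N r c)); tauto.
Qed.

(** A condition of [T] says that the value of [phi - psi] lies in the set [y <= 0], which is a first
    order property. It is valid in [M0], hence in [N], and the identity map identifies [N] with
    [discrete_structure] read as a first order structure. *)
Lemma discrete_models (T : Ltheory L) : Models M0 T -> Models discrete_structure T.
Proof.
  intros HM0 phi psi Hc.
  destruct (formula_finitely_valued (fadd phi (fscal (-1) psi))) as [_ [_ HA]].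
  destruct (HA (fun y => y <= 0)) as [s Hs]. intros e.
  assert (Hsat : fsat (fo_of discrete_structure) s e).
  { apply (fsat_iso discrete_structure N (fun x => x) (fun x => x)); auto.
    - intros r c. apply discrete_rel_one.
    - apply (fo_theory_models M0 N s HN). intros e'. apply Hs; auto. simpl.
      specialize (HM0 phi psi Hc e'). lra. }
  apply (Hs _ discrete_first_order) in Hsat. simpl in Hsat. lra.
Qed.
End Discrete.
End FirstOrderTheory.

Theorem mainTheorem1 (L : language) (T : Ltheory L) :
  complete_theory T ->
  (exists M : Lstructure L, Models M T /\ first_order_model M) ->
  (forall M : Lstructure L, Models M T -> (first_order_model M <-> extremal T M)) /\
  (exists Te : FOtheory L, FO_complete Te /\
     forall N : FOstructure L,
       FModels N Te <->
       exists M : Lstructure L, Models M T /\ first_order_model M /\ iso_FO M N).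
Proof.
  intros HT [M0 HM0]. split.
  { intros M HM. split.
    - intros Hfo. apply (fo_model_extremal T HT M0 HM0). now split.
    - now apply (extremal_fo_model T HT M0 HM0). }
  (* The theory of one first order model suffices, since [fsat_transfer] makes its sentences true in
     all the others. *)
  exists (fo_theory M0). split; [apply fo_theory_complete|]. intros N. split.
  - intros HN. exists (discrete_structure M0 (proj2 HM0) N HN). split; [|split].
    + apply discrete_models, HM0.
    + apply discrete_first_order.
    + exists (fun x => x), (fun x => x). repeat split; auto; apply discrete_rel_one.
  - intros [M [HM [Hfo (h & g & Hgh & Hhg & HF & HR)]]] s [_ Hs] e.
    replace e with (fun i => h (g (e i)))
      by (apply functional_extensionality; intros i; apply Hhg).
    apply (fsat_iso M N h g Hgh Hhg HF HR s (fun i => g (e i))).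
    now apply (fsat_transfer T HT M0 HM0 s M (conj HM Hfo)).
Qed.
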